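(* Let $K$ be a differential field of characteristic $0$ with $m$ commuting derivations, let $V\subseteq\mathbb A^n$ be a differential algebraic variety over $K$ of dimension $d$, and let $\bar a\in\mathbb A^n$. Let $H_1,\dots,H_{d+1}$ be independent generic differential hypersurfaces through $\bar a$, each of arbitrary order and degree. If $V\cap H_1\cap\dots\cap H_{d+1}\neq\emptyset$, then $\bar a\in V$.
   Context: Points are taken in a large differentially closed field extending $K$. A generic differential hypersurface through $\bar a$ of order $s$ and degree $r$ is the zero set of $\sum_i c_i\,(m_i(\bar y)-m_i(\bar a))$, where the $m_i$ range over all differential monomials other than $1$ in $y_1,\dots,y_n$ of order at most $s$ and degree at most $r$; ''independent generic'' means that the coefficients of all $H_1,\dots,H_{d+1}$ together form a family of independent differential transcendentals over $K\langle\bar a\rangle$. The dimension of a differential algebraic variety over $K$ is the differential transcendence degree over $K$ of the differential field generated by a generic point (for a variety with several $K$-irreducible components, the maximum over its components). *)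

(* Defs.v *)
From HB Require Import structures.
From mathcomp Require Import all_boot all_order all_algebra.
From mathcomp Require Import finmap.
From mathcomp.multinomials Require Import monalg.

Set Implicit Arguments.
Unset Strict Implicit.
Unset Printing Implicit Defensive.

Import GRing.Theory.

Local Open Scope ring_scope.

HB.mixin Record Field_isDifferential (m : nat) R of GRing.Field R := {
  der : 'I_m -> R -> R;
  derD : forall i x y, der i (x + y) = der i x + der i y;
  derM : forall i x y, der i (x * y) = der i x * y + x * der i y;
  derC : forall i j x, der i (der j x) = der j (der i x)
}.

#[short(type="diffFieldType")]
HB.structure Definition DiffField (m : nat) :=
  { R of GRing.Field R & Field_isDifferential m R }.

Definition diff_embedding (m : nat) (K L : diffFieldType m)
    (f : {rmorphism K -> L}) : Prop :=
  forall (i : 'I_m) (x : K), f (der i x) = der i (f x).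

Definition image_pred (S T : Type) (f : S -> T) (y : T) : Prop :=
  exists x, f x = y.

(* The derivative operator t stands for the product of the der_i ^ (t i). *)
Definition dop (m : nat) := {ffun 'I_m -> nat}.

Definition dop_app (m : nat) (R : diffFieldType m) (t : dop m) (x : R) : R :=
  foldr (fun i z => iter (t i) (der i) z) x (enum 'I_m).

(* Differential polynomials over R in the differential indeterminates y_i,    *)
(* i : I, i.e., polynomials in the algebraic indeterminates t y_i, where the  *)
(* pair (i, t) stands for t y_i.                                              *)
Definition dmonom (m : nat) (I : choiceType) := {cmonom (I * dop m)%type}.

Definition dpoly (m : nat) (R : diffFieldType m) (I : choiceType) :=
  {malg R[dmonom m I]}.

Definition dmonom_eval (m : nat) (R : diffFieldType m) (I : choiceType)
    (x : I -> R) (mo : dmonom m I) : R :=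
  \prod_(v <- finsupp mo) dop_app v.2 (x v.1) ^+ mo v.

Definition deval_in (m : nat) (R S : diffFieldType m) (f : R -> S)
    (I : choiceType) (x : I -> S) (P : dpoly R I) : S :=
  mmap f (dmonom_eval x) P.

Definition deval (m : nat) (R : diffFieldType m) (I : choiceType)
    (x : I -> R) (P : dpoly R I) : R :=
  deval_in idfun x P.

Section Subfields.
Variables (m : nat) (U : diffFieldType m).
Implicit Types (F E L : U -> Prop) (I : choiceType).

Definition diff_subfield F : Prop :=
  [/\ F 1,
      forall x y, F x -> F y -> F (x - y),
      forall x y, F x -> F y -> F (x / y)
    & forall (i : 'I_m) x, F x -> F (der i x)].

(* F<x>, the smallest differential subfield containing F and all the x i *)
Definition diff_adjoin F I (x : I -> U) (z : U) : Prop :=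
  forall E, diff_subfield E -> (forall y, F y -> E y) ->
    (forall i, E (x i)) -> E z.

Definition dpoly_over F I (P : dpoly U I) : Prop :=
  forall mo : dmonom m I, F P@_mo.

(* The x i are independent differential transcendentals over F; as a family,  *)
(* so that in particular they are pairwise distinct.                          *)
Definition diff_indep F I (x : I -> U) : Prop :=
  forall P : dpoly U I, dpoly_over F P -> deval x P = 0 -> P = 0.

Definition diff_algebraic F (z : U) : Prop :=
  exists P : dpoly U unit,
    [/\ dpoly_over F P, P <> 0 & deval (fun=> z) P = 0].

Definition diff_trbasis F L (e : nat) (b : 'I_e -> U) : Prop :=
  [/\ forall i, L (b i),
      diff_indep F b
    & forall z, L z -> diff_algebraic (diff_adjoin F b) z].

Definition diff_trdeg F L (e : nat) : Prop :=
  exists b : 'I_e -> U, diff_trbasis F L b.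

End Subfields.

(* U is existentially closed among its differential field extensions. *)
Definition diff_closed (m : nat) (U : diffFieldType m) : Prop :=
  forall (k : nat) (Ps : seq (dpoly U 'I_k)) (Q : dpoly U 'I_k),
    (exists (L : diffFieldType m) (f : {rmorphism U -> L}) (x : 'I_k -> L),
      [/\ diff_embedding f,
          forall P, P \in Ps -> deval_in f x P = 0
        & deval_in f x Q <> 0]) ->
    exists x : 'I_k -> U,
      (forall P, P \in Ps -> deval x P = 0) /\ deval x Q <> 0.

(* Saturation of U with respect to the quantifier-free types over the         *)
(* differential subfields of cardinality at most that of K. By elimination of *)
(* quantifiers, a differentially closed field of characteristic 0 has this    *)
(* property if and only if it is |K|^+-saturated (K being infinite).          *)
Definition large_over (m : nat) (K U : diffFieldType m) : Prop :=
  forall F : U -> Prop, diff_subfield F ->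
    (exists h : U -> K, forall x y, F x -> F y -> h x = h y -> x = y) ->
  forall (k : nat) (Eq Neq : dpoly U 'I_k -> Prop),
    (forall P, Eq P -> dpoly_over F P) ->
    (forall Q, Neq Q -> dpoly_over F Q) ->
    (forall Ps Qs : seq (dpoly U 'I_k),
      (forall P, P \in Ps -> Eq P) -> (forall Q, Q \in Qs -> Neq Q) ->
      exists x : 'I_k -> U,
        (forall P, P \in Ps -> deval x P = 0) /\
        (forall Q, Q \in Qs -> deval x Q <> 0)) ->
    exists x : 'I_k -> U,
      (forall P, Eq P -> deval x P = 0) /\
      (forall Q, Neq Q -> deval x Q <> 0).

Section Varieties.
Variables (m n : nat) (U : diffFieldType m).
Implicit Types (K : U -> Prop) (V W : ('I_n -> U) -> Prop).

Definition dvariety K V : Prop :=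
  exists2 Sigma : dpoly U 'I_n -> Prop,
    (forall P, Sigma P -> dpoly_over K P) &
    (forall x, V x <-> forall P, Sigma P -> deval x P = 0).

Definition irreducible_dvariety K W : Prop :=
  [/\ dvariety K W,
      exists x, W x
    & forall W1 W2, dvariety K W1 -> dvariety K W2 ->
        (forall x, W x -> W1 x \/ W2 x) ->
        (forall x, W x -> W1 x) \/ (forall x, W x -> W2 x)].

Definition irreducible_component K V W : Prop :=
  [/\ irreducible_dvariety K W,
      forall x, W x -> V x
    & forall W', irreducible_dvariety K W' -> (forall x, W' x -> V x) ->
        (forall x, W x -> W' x) -> forall x, W' x -> W x].

Definition generic_point K W (g : 'I_n -> U) : Prop :=
  W g /\ forall P : dpoly U 'I_n, dpoly_over K P -> deval g P = 0 ->
    forall x, W x -> deval x P = 0.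

Definition irreducible_dim K W (e : nat) : Prop :=
  exists2 g, generic_point K W g & diff_trdeg K (diff_adjoin K g) e.

(* The maximum over the components is required to be attained: the empty      *)
(* variety has no dimension.                                                  *)
Definition dvariety_dim K V (d : nat) : Prop :=
  (exists2 W, irreducible_component K V W & irreducible_dim K W d) /\
  (forall W e, irreducible_component K V W -> irreducible_dim K W e ->
    (e <= d)%N).

End Varieties.

Definition bounded_dop (m s : nat) :=
  {t : {ffun 'I_m -> 'I_s.+1} | (\sum_i t i <= s)%N}.
HB.instance Definition _ (m s : nat) := Finite.on (bounded_dop m s).

Definition dop_of_bounded (m s : nat) (t : bounded_dop m s) : dop m :=
  [ffun i => val t i : nat].

(* The finite type of the differential monomials other than 1 in y_1 .. y_n   *)
(* of order at most s and degree at most r, given by the exponents of the     *)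
(* derivatives of order at most s of the y_i.                                 *)
Definition bounded_dmonom (m n s r : nat) :=
  {e : {ffun 'I_n * bounded_dop m s -> 'I_r.+1} | (0 < \sum_v e v <= r)%N}.
HB.instance Definition _ (m n s r : nat) :=
  Finite.on (bounded_dmonom m n s r).

Definition bounded_dmonom_eval (m n s r : nat) (U : diffFieldType m)
    (y : 'I_n -> U) (e : bounded_dmonom m n s r) : U :=
  \prod_v dop_app (dop_of_bounded v.2) (y v.1) ^+ val e v.

Definition hypersurface_through (m n s r : nat) (U : diffFieldType m)
    (a : 'I_n -> U) (c : bounded_dmonom m n s r -> U) (y : 'I_n -> U) : Prop :=
  \sum_e c e * (bounded_dmonom_eval y e - bounded_dmonom_eval a e) = 0.

(* The coefficients of all the hypersurfaces, as one family. *)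
Definition all_coefficients (m n k : nat) (s r : 'I_k -> nat)
    (U : diffFieldType m) (c : forall j, bounded_dmonom m n (s j) (r j) -> U)
    (p : {j : 'I_k & bounded_dmonom m n (s j) (r j)}) : U :=
  c (tag p) (tagged p).

(* Main.v *)
(* Algebraic closure inside U is a pregeometry, and in characteristic 0 it is *)
(* compatible with derivations. If y is differentially algebraic over E<b>,   *)
(* some derivative t0 y is algebraic over E<b> and derivatives of y of        *)
(* smaller weight, hence so are all derivatives of t0 y. Therefore, up to a   *)
(* negligible proportion, derivatives of bounded weight of elements of        *)
(* E<b, y> are algebraic over those of b; comparing numbers of derivatives,   *)
(* E<b, y> has no more independent differential transcendentals than the      *)
(* length of b.                                                               *)
(*   A point y of V lies on a component of V by Zorn's lemma, and is a        *)
(* specialization of its generic point, so K<y> has differential              *)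
(* transcendence degree at most d. If y lies on all the H_j and y_i <> a_i,   *)
(* each equation gives the coefficient of y_i in H_j as an element of the     *)
(* field generated by K<a>, y and the other coefficients. So the N            *)
(* coefficients lie in an extension of K<a> of differential transcendence     *)
(* degree at most d + (N - (d + 1)) < N, a contradiction.                     *)

Require Import Defs.
From HB Require Import structures.
From mathcomp Require Import all_boot all_order all_algebra.
From mathcomp Require Import finmap boolp zify.
From mathcomp.multinomials Require Import monalg.
From mathcomp.classical Require classical_sets.

Set Implicit Arguments.
Unset Strict Implicit.
Unset Printing Implicit Defensive.

Import GRing.Theory.

Local Open Scope ring_scope.

(** The engine is [diff_indep_leq_card]: if finitely many elements [y i] are differentially
    algebraic over E<b>, then E<b, y> contains at most [#|J1|] independent differential
    transcendentals over E, where [J1] indexes [b]. Its proof counts derivatives. By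
    [diff_indep_acl], all derivatives of an independent family [z] are algebraically independent
    over E. By [diff_algebraic_leader] and [acl_over_nonmultiples], each [y i] contributes, up to
    algebraic closure, only derivatives that are not multiples of one leader. The Steinitz bound
    [pregeometry_size] compares the two counts in each weight, and if [z] were longer than [b], the
    number of operators of bounded weight would grow exponentially, against [poly_growth_absurd].

    For the geometric part, suppose a point y of V lies on every H_j and y_i differs from a_i.
    [component_through] puts y on a component with generic point g, and [specializes_diff_indep]
    lifts a transcendence basis of F<y> to g, so that it has at most d elements. Solving each
    equation for the coefficient of y_i puts all N coefficients in a field generated over F<a> by
    this basis, the remaining N - (d + 1) coefficients and the coordinates of y, which are
    differentially algebraic over the basis. The engine then gives N <= d + N - (d + 1), which is
    absurd. *)

(** * Independent sets in a pregeometry *)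

Section Pregeometry.
Variables (T : eqType) (cl : (T -> Prop) -> T -> Prop).
Implicit Types (X Y : T -> Prop).

Definition pregeometry : Prop :=
  [/\ forall X u, X u -> cl X u,
      forall X Y u, (forall v, X v -> cl Y v) -> cl X u -> cl Y u
    & forall X y z, cl (fun u => X u \/ u = y) z -> ~ cl X z ->
        cl (fun u => X u \/ u = z) y].

Hypothesis cl_pregeo : pregeometry.

(** Steinitz exchange, moving the generators one by one from [G] into the base [B]. Adding [g] to
    the base either keeps the family independent or makes some [x v] depend on the others. In the
    second case [v] is dropped, and the rest is independent over the new base: a further dependence
    of [x u] would, by exchange, put [g] in the closure of the family without [v], and then [x v] as
    well. *)
Lemma pregeometry_size (I : eqType) (x : I -> T) (G : seq T) :
  forall (B : T -> Prop) (s : seq I), uniq s ->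
  (forall v, v \in s ->
    ~ cl (fun u => B u \/ exists2 i, (i \in s) && (i != v) & u = x i) (x v)) ->
  (forall v, v \in s -> cl (fun u => B u \/ u \in G) (x v)) ->
  (size s <= size G)%N.
Proof.
have [cl_ext cl_idem cl_exch] := cl_pregeo.
have cl_mono X Y u : (forall v, X v -> Y v) -> cl X u -> cl Y u.
  by move=> XY; apply: cl_idem => v /XY; apply: cl_ext.
elim: G => [|g G IH] B s s_uniq s_indep s_cl.
  case: s s_uniq s_indep s_cl => [//|v s] _ /(_ v (mem_head _ _)) nv.
  move=> /(_ v (mem_head _ _)) cv; case: nv; apply: cl_mono cv => u [?|//].
  by left.
pose B' u := B u \/ u = g.
have cl_B' s' : (forall v, v \in s' -> v \in s) ->
    forall v, v \in s' -> cl (fun u => B' u \/ u \in G) (x v).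
  move=> ss' v /ss'/s_cl; apply: cl_mono => u; rewrite inE => -[Bu|/predU1P[->|Gu]].
  - by left; left.
  - by left; right.
  - by right.
case: (pselect (forall v, v \in s ->
    ~ cl (fun u => B' u \/ exists2 i, (i \in s) && (i != v) & u = x i) (x v))).
  move=> indep'; apply: leqW; apply: (IH B' s) => //.
  exact: cl_B'.
move=> /existsNP[v /not_implyP[vs /contrapT xv]].
have g_cl : cl (fun u => (B u \/ exists2 i, (i \in s) && (i != v) & u = x i)
                         \/ u = g) (x v).
  by apply: cl_mono xv => u [[?|?]|?]; [left; left|right|left; right].
rewrite (_ : size s = (size (rem v s)).+1); last first.
  by rewrite size_rem // prednK //; case: s vs {s_uniq s_indep s_cl cl_B' xv g_cl}.
rewrite ltnS; apply: (IH B'); first exact: rem_uniq.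
- move=> u; rewrite mem_rem_uniq // inE => /andP[uv us] xu.
  pose X0 w := B w \/ exists2 i, [&& i \in s, i != v & i != u] & w = x i.
  have X0s w : X0 w -> B w \/ exists2 i, (i \in s) && (i != u) & w = x i.
    by case=> [?|[i /and3P[is_ iv iu] ->]]; [left|right; exists i => //; apply/andP].
  have g_in : cl (fun w => X0 w \/ w = x u) g.
    apply: cl_exch; last by move=> H; apply: (s_indep u us); apply: cl_mono H.
    apply: cl_mono xu => w [[?|?]|[i]]; [by left; left|by right|].
    rewrite mem_rem_uniq // inE => /andP[/andP[iv is_] iu ->].
    by left; right; exists i => //; apply/and3P.
  apply: (s_indep v vs); apply: cl_idem g_cl => w [|->]; first exact: cl_ext.
  apply: cl_mono g_in => t [[?|[i /and3P[is_ iv iu] ->]]|->]; first by left.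
    by right; exists i => //; apply/andP.
  by right; exists u => //; apply/andP.
- by apply: cl_B' => u /mem_rem.
Qed.

End Pregeometry.

(** * Relative algebraic closure as a pregeometry, and derivations *)

Section AlgebraicClosure.
Variable U : fieldType.
Implicit Types (F L X Y : U -> Prop) (p : {poly U}).

Definition subfield F : Prop :=
  [/\ F 1, forall x y, F x -> F y -> F (x - y)
    & forall x y, F x -> F y -> F (x / y)].

Definition poly_over F p : Prop := forall i, F p`_i.

Definition alg_over F (u : U) : Prop :=
  exists2 p, poly_over F p & p != 0 /\ root p u.

(* Algebraically closed in U, as opposed to algebraically closed. *)
Definition rel_alg_closed L : Prop :=
  subfield L /\ forall u, alg_over L u -> L u.

(** As an intersection of relatively algebraically closed subfields, the closure comes with an
    induction principle: a property holds on [acl X] as soon as it holds on [X] and defines such a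
    subfield. *)
Definition acl X (u : U) : Prop :=
  forall L, rel_alg_closed L -> (forall v, X v -> L v) -> L u.

Section SubfieldTheory.
Variables (F : U -> Prop) (F_sub : subfield F).

Lemma subfield1 : F 1. Proof. by case: F_sub. Qed.
Lemma subfieldB x y : F x -> F y -> F (x - y).
Proof. by case: F_sub => _ H _; apply: H. Qed.
Lemma subfield_div x y : F x -> F y -> F (x / y).
Proof. by case: F_sub => _ _ H; apply: H. Qed.
Lemma subfield0 : F 0.
Proof. by rewrite -(subrr 1); apply: subfieldB; apply: subfield1. Qed.
Lemma subfieldN x : F x -> F (- x).
Proof. by rewrite -sub0r; apply: subfieldB; apply: subfield0. Qed.
Lemma subfieldD x y : F x -> F y -> F (x + y).
Proof. by move=> Fx Fy; rewrite -(opprK y); apply/subfieldB/subfieldN. Qed.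
Lemma subfieldV x : F x -> F x^-1.
Proof. by rewrite -div1r; apply: subfield_div; apply: subfield1. Qed.
Lemma subfieldM x y : F x -> F y -> F (x * y).
Proof. by move=> Fx Fy; rewrite -(invrK y); apply/subfield_div/subfieldV. Qed.
Lemma subfieldX x n : F x -> F (x ^+ n).
Proof.
move=> Fx; elim: n => [|n IH]; first by rewrite expr0; apply: subfield1.
by rewrite exprS; apply: subfieldM.
Qed.
Lemma subfield_sum (I : Type) (r : seq I) (P : pred I) (f : I -> U) :
  (forall i, P i -> F (f i)) -> F (\sum_(i <- r | P i) f i).
Proof. by move=> H; apply: big_ind => //; [apply: subfield0|apply: subfieldD]. Qed.
Lemma subfield_prod (I : Type) (r : seq I) (P : pred I) (f : I -> U) :
  (forall i, P i -> F (f i)) -> F (\prod_(i <- r | P i) f i).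
Proof. by move=> H; apply: big_ind => //; [apply: subfield1|apply: subfieldM]. Qed.
Lemma subfield_horner p u : poly_over F p -> F u -> F p.[u].
Proof.
move=> Fp Fu; rewrite horner_coef; apply: subfield_sum => i _.
by apply: subfieldM; [apply: Fp|apply: subfieldX].
Qed.

End SubfieldTheory.

(** Turns a subfield given by a predicate into a field type, so that the library theory of
    [algebraicOver] applies to it. *)
Record subfield_bundle := SubfieldBundle {
  bundle_pred : U -> Prop;
  bundleP : subfield bundle_pred }.

Section Bundle.
Variable F : subfield_bundle.

Definition in_bundle : {pred U} := fun x => `[< bundle_pred F x >].

Lemma in_bundleP x : reflect (bundle_pred F x) (x \in in_bundle).
Proof. exact: asboolP. Qed.

Fact in_bundle_divring : divring_closed in_bundle.
Proof.
have FP := bundleP F.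
by split=> [|x y /asboolP Fx /asboolP Fy|x y /asboolP Fx /asboolP Fy];
  apply/asboolP; [apply: subfield1|apply: subfieldB|apply: subfield_div].
Qed.
HB.instance Definition _ := GRing.isDivringClosed.Build U in_bundle in_bundle_divring.

Record bundle_type := BundleType { bundle_val : U; _ : bundle_val \in in_bundle }.
HB.instance Definition _ := [isSub for bundle_val].
HB.instance Definition _ := [Choice of bundle_type by <:].
HB.instance Definition _ := [SubChoice_isSubIntegralDomain of bundle_type by <:].
HB.instance Definition _ := [SubIntegralDomain_isSubField of bundle_type by <:].

Lemma alg_over_algebraicOver u :
  alg_over (bundle_pred F) u <-> algebraicOver (\val : bundle_type -> U) u.
Proof.
split=> [[p Fp [p0 pu]]|[p p0 pu]].
  have Fp' i : p`_i \in in_bundle by apply/in_bundleP.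
  pose q := \poly_(i < size p) (Sub p`_i (Fp' i) : bundle_type).
  have qE : map_poly \val q = p.
    apply/polyP=> i; rewrite coef_map coef_poly; case: ltnP => [//|le_pi].
    by rewrite nth_default.
  by exists q; rewrite ?qE // -(map_poly_eq0 (\val : {rmorphism bundle_type -> U})) qE.
exists (map_poly \val p); first by move=> i; rewrite coef_map; apply/in_bundleP/valP.
by rewrite map_poly_eq0.
Qed.

Lemma alg_over_rel_closed : rel_alg_closed (alg_over (bundle_pred F)).
Proof.
split; first split.
- exact/alg_over_algebraicOver/algebraic1.
- move=> x y /alg_over_algebraicOver ax /alg_over_algebraicOver ay.
  exact/alg_over_algebraicOver/algebraic_sub.
- move=> x y /alg_over_algebraicOver ax /alg_over_algebraicOver ay.
  exact/alg_over_algebraicOver/algebraic_div.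
move=> u [p pF [p0 pu]]; apply/alg_over_algebraicOver/integral_algebraic.
apply: integral_root p0 pu _; apply/integral_poly => i.
by apply/integral_algebraic/alg_over_algebraicOver.
Qed.
End Bundle.

Lemma alg_over_closed F : subfield F -> rel_alg_closed (alg_over F).
Proof. by move=> FP; apply: (alg_over_rel_closed (SubfieldBundle FP)). Qed.

Lemma sub_alg_over F : subfield F -> forall u, F u -> alg_over F u.
Proof.
move=> FP u Fu; exists ('X - u%:P); last by rewrite polyXsubC_eq0 root_XsubC.
move=> i; rewrite coefB coefX coefC; apply: subfieldB => //.
  by case: (i == 1%N); [apply: subfield1|apply: subfield0].
by case: (i == 0%N) => //; apply: subfield0.
Qed.

Lemma acl_closed X : rel_alg_closed (acl X).
Proof.
split; first split.
- by move=> L [LP _] _; apply: subfield1.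
- by move=> x y ax ay L LP XL; apply: subfieldB; [case: LP|apply: ax|apply: ay].
- by move=> x y ax ay L LP XL; apply: subfield_div; [case: LP|apply: ax|apply: ay].
move=> u [p pX [p0 pu]] L LP XL; apply: (proj2 LP); exists p => // i.
exact: pX.
Qed.

Lemma acl_subfield X : subfield (acl X). Proof. by case: (acl_closed X). Qed.

Lemma acl_ext X u : X u -> acl X u.
Proof. by move=> Xu L _; apply. Qed.

Lemma acl_idem X Y u : (forall v, X v -> acl Y v) -> acl X u -> acl Y u.
Proof. by move=> XY; apply => //; apply: acl_closed. Qed.

Lemma acl_mono X Y u : (forall v, X v -> Y v) -> acl X u -> acl Y u.
Proof. by move=> XY; apply: acl_idem => v /XY; apply: acl_ext. Qed.

Section Fractions.
Variables (R : U -> Prop) (R1 : R 1) (RB : forall x y, R x -> R y -> R (x - y)).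
Variable RM : forall x y, R x -> R y -> R (x * y).

(** The fraction field, inside [U], of a subring [R]. Clearing denominators turns algebraicity over
    it into a polynomial relation with coefficients in [R]. *)
Definition fractions (u : U) : Prop :=
  exists x y, [/\ R x, R y, y != 0 & u = x / y].

Let R0 : R 0. Proof. by rewrite -(subrr 1); apply: RB. Qed.

Lemma fractions_subfield : subfield fractions.
Proof.
split.
- by exists 1, 1; rewrite oner_neq0 divr1.
- move=> _ _ [x [y [Rx Ry y0 ->]]] [z [t [Rz Rt t0 ->]]].
  exists (x * t - z * y), (y * t); split; rewrite ?mulf_neq0 //.
  - by apply: RB; apply: RM.
  - exact: RM.
  - by rewrite -mulNr addf_div // mulNr.
- move=> _ _ [x [y [Rx Ry y0 ->]]] [z [t [Rz Rt t0 ->]]].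
  have [->|z0] := eqVneq z 0.
    by exists 0, 1; rewrite oner_neq0 !mul0r invr0 mulr0.
  exists (x * t), (y * z); split; rewrite ?mulf_neq0 //; try exact: RM.
  by rewrite invf_div mulf_div.
Qed.

Lemma fractions_common_denominator (n : nat) (f : nat -> U) :
  (forall i, fractions (f i)) ->
  exists2 q, R q /\ q != 0 & forall i, (i < n)%N -> R (q * f i).
Proof.
move=> Ff; elim: n => [|n [q [Rq q0] qf]].
  by exists 1; rewrite ?oner_neq0.
have [x [y [Rx Ry y0 fn]]] := Ff n.
exists (q * y); first by split; [apply: RM|rewrite mulf_neq0].
move=> i; rewrite ltnS leq_eqVlt => /predU1P[->|lt_in].
  by rewrite fn -mulrA (mulrCA y) divff // mulr1; apply: RM.
by rewrite mulrAC; apply: RM => //; apply: qf.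
Qed.

Lemma alg_over_fractions u : alg_over fractions u -> alg_over R u.
Proof.
move=> [p pF [p0 pu]].
have [q [Rq q0] qp] := fractions_common_denominator (size p) pF.
exists (q *: p); last first.
  by split; [rewrite scale_poly_eq0 negb_or q0|rewrite rootZ].
move=> i; rewrite coefZ; have [/qp//|le_pi] := ltnP i (size p).
by rewrite nth_default // mulr0.
Qed.

End Fractions.

(** With L the closure of [X], [z] is a root of a nonzero polynomial over L[y], which is a relation
    over L in two variables. Sorted by powers of [y], its coefficients are the [(Q j).[z]]. They
    cannot all vanish, since some [Q j] is nonzero and [z] is not algebraic over L; hence [y] is
    algebraic over L(z). *)
Lemma acl_exchange X y z :
  acl (fun u => X u \/ u = y) z -> ~ acl X z -> acl (fun u => X u \/ u = z) y.
Proof.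
move=> zXy nz; have LP := acl_subfield X; set L := acl X in LP nz.
pose R u := exists2 p, poly_over L p & u = p.[y].
have R1 : R 1.
  exists 1; last by rewrite hornerC.
  by move=> i; rewrite coefC; case: ifP => _; [apply: (subfield1 LP)|apply: (subfield0 LP)].
have RB u v : R u -> R v -> R (u - v).
  move=> [p Lp ->] [q Lq ->]; exists (p - q); last by rewrite hornerD hornerN.
  by move=> i; rewrite coefB; apply: (subfieldB LP).
have RM u v : R u -> R v -> R (u * v).
  move=> [p Lp ->] [q Lq ->]; exists (p * q); last by rewrite hornerM.
  by move=> i; rewrite coefM; apply: (subfield_sum LP) => j _; apply: (subfieldM LP).
have RF u : R u -> fractions R u.
  by move=> Ru; exists u, 1; rewrite oner_neq0 divr1.
have FP := fractions_subfield R1 RB RM.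
have /(alg_over_fractions R1 RB RM)[p pR [p0 pz]] : alg_over (fractions R) z.
  apply: zXy; first exact: alg_over_closed.
  move=> v [Xv|->]; apply: (sub_alg_over FP); apply: RF.
    exists v%:P; last by rewrite hornerC.
    move=> i; rewrite coefC; case: ifP => _; last exact: (subfield0 LP).
    exact: acl_ext.
  exists 'X; last by rewrite hornerX.
  by move=> i; rewrite coefX; case: eqP => _; [apply: (subfield1 LP)|apply: (subfield0 LP)].
have /choice[P PP] i : exists q, poly_over L q /\ p`_i = q.[y].
  by have [q ? ?] := pR i; exists q.
pose N := (\max_(i < size p) size (P i))%N.
pose Q j := \poly_(i < size p) (P i)`_j.
have QL j : poly_over L (Q j).
  move=> i; rewrite coef_poly; case: ifP => _; last exact: (subfield0 LP).
  by apply: (proj1 (PP i)).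
have QE : \sum_(j < N) (Q j).[z] * y ^+ j = 0.
  transitivity p.[z]; last exact/eqP.
  rewrite horner_coef.
  under eq_bigr => j _ do rewrite horner_poly big_distrl /=.
  rewrite exchange_big /=; apply: eq_bigr => i _.
  rewrite (proj2 (PP i)) (@horner_coef_wide _ N) ?big_distrl /=; last first.
    exact: (leq_bigmax (F := fun i : 'I_(size p) => size (P i))).
  by apply: eq_bigr => j _; rewrite mulrAC.
case: (pselect (forall j, (j < N)%N -> (Q j).[z] = 0)) => [Q0|].
  case: nz; apply: (proj2 (acl_closed X)).
  have : lead_coef p != 0 by rewrite lead_coef_eq0.
  rewrite lead_coefE => lp; set i := (size p).-1 in lp.
  have ip : (i < size p)%N by rewrite /i prednK // lt0n size_poly_eq0.
  have [j Pij] : exists j, (P i)`_j != 0.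
    apply/not_existsP => H; case/eqP: lp; rewrite (proj2 (PP i)).
    rewrite (_ : P i = 0) ?horner0 //; apply/polyP=> j; rewrite coef0.
    by apply/eqP/negPn/negP; apply: H.
  have jN : (j < N)%N.
    have := leq_bigmax (F := fun i : 'I_(size p) => size (P i)) (Ordinal ip).
    apply: leq_trans; rewrite ltnNge.
    by apply: contra Pij => /(nth_default 0)->.
  exists (Q j) => //; split; last by apply/eqP/Q0.
  apply: contra Pij => /eqP/(congr1 (fun q : {poly U} => q`_i)).
  by rewrite coef_poly ip coef0 => ->.
move=> /existsNP[j /not_implyP[jN /eqP Qj]].
have [cP cC] := acl_closed (fun u => X u \/ u = z).
apply: cC; exists (\poly_(j < N) (Q j).[z]).
  move=> i; rewrite coef_poly; case: ifP => _; last exact: (subfield0 cP).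
  apply: (subfield_horner cP); last by apply: acl_ext; right.
  by move=> k; apply: acl_mono (QL i k) => u; left.
split; last by rewrite /root horner_poly QE.
apply: contra Qj => /eqP/(congr1 (fun q : {poly U} => q`_j)).
by rewrite coef_poly jN coef0 => ->.
Qed.

Lemma acl_pregeometry F : pregeometry (fun X => acl (fun u => F u \/ X u)).
Proof.
split.
- by move=> X u Xu; apply: acl_ext; right.
- move=> X Y u XY; apply: acl_idem => v [Fv|/XY//].
  by apply: acl_ext; left.
- move=> X y z zy nz; apply: acl_mono (acl_exchange (X := fun u => F u \/ X u) _ nz).
    by move=> v [[?|?]|->]; [left|right; left|right; right].
  by apply: acl_mono zy => v [?|[?|->]]; [left; left|left; right|right].
Qed.

(** Finite character: a polynomial has finitely many coefficients, so the increasing union of the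
    closures is already relatively algebraically closed. *)
Lemma acl_directed (X : nat -> U -> Prop) u :
  (forall k l v, (k <= l)%N -> X k v -> X l v) ->
  acl (fun v => exists k, X k v) u -> exists k, acl (X k) u.
Proof.
move=> Xmono; have aclm k l v : (k <= l)%N -> acl (X k) v -> acl (X l) v.
  by move=> kl; apply: acl_mono => w; apply: Xmono.
move/(_ (fun v => exists k, acl (X k) v)); apply; last first.
  by move=> v [k Xv]; exists k; apply: acl_ext.
split; first split.
- by exists 0%N; apply: (subfield1 (acl_subfield _)).
- move=> x y [k xk] [l yl]; exists (maxn k l); apply: (subfieldB (acl_subfield _)).
  + by apply: aclm xk; apply: leq_maxl.
  + by apply: aclm yl; apply: leq_maxr.
- move=> x y [k xk] [l yl]; exists (maxn k l); apply: (subfield_div (acl_subfield _)).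
  + by apply: aclm xk; apply: leq_maxl.
  + by apply: aclm yl; apply: leq_maxr.
move=> v [p pX [p0 pv]]; have /choice[k kP] := pX.
exists (\max_(i < size p) k i)%N; apply: (proj2 (acl_closed _)); exists p => // i.
have [lt_ip|le_pi] := ltnP i (size p); last first.
  by rewrite nth_default //; apply: (subfield0 (acl_subfield _)).
apply: aclm (kP i).
exact: (leq_bigmax (F := fun i : 'I_(size p) => k i) (Ordinal lt_ip)).
Qed.

(* If p is of minimal degree among the polynomials over L that kill u, then   *)
(* p' does not kill u since the characteristic is 0, so that                  *)
(* D(p(u)) = p^D(u) + p'(u) D(u) = 0 determines D(u).                         *)
Lemma acl_derivation (D : U -> U) X Y u :
  [pchar U] =i pred0 ->
  (forall x y, D (x + y) = D x + D y) ->
  (forall x y, D (x * y) = D x * y + x * D y) ->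
  (forall v, X v -> acl Y v) -> (forall v, X v -> acl Y (D v)) ->
  acl X u -> acl Y (D u).
Proof.
move=> char0 DD DM XY XDY aXu.
have YP := acl_subfield Y.
have D0 : D 0 = 0 by apply: (@addrI _ (D 0)); rewrite -DD !addr0.
have D1 : D 1 = 0.
  by apply: (@addrI _ (D 1)); rewrite addr0 -{3}(mulr1 1) DM mulr1 mul1r.
have DN x : D (- x) = - D x.
  by apply: (@addrI _ (D x)); rewrite -DD !subrr.
(* The elements that lie in [acl Y] together with their image under [D] are shown to form a
   relatively algebraically closed subfield. *)
suff [//] : acl Y u /\ acl Y (D u).
apply: (aXu (fun v => acl Y v /\ acl Y (D v))); last first.
  by move=> v Xv; split; [apply: XY|apply: XDY].
split; first split.
- by rewrite D1; split; [apply: (subfield1 YP)|apply: (subfield0 YP)].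
- move=> x y [ax aDx] [ay aDy]; split; first exact: (subfieldB YP).
  by rewrite DD DN; apply: (subfieldB YP).
- move=> x y [ax aDx] [ay aDy]; split; first exact: (subfield_div YP).
  have [->|y0] := eqVneq y 0; first by rewrite invr0 mulr0 D0; apply: (subfield0 YP).
  have -> : D (x / y) = (D x - x / y * D y) / y.
    apply: (mulIf y0); rewrite divfK //; apply: (@addIr _ (x / y * D y)).
    by rewrite -DM divfK // subrK.
  apply: (subfield_div YP) => //; apply: (subfieldB YP) => //.
  by apply: (subfieldM YP) => //; apply: (subfield_div YP).
move=> v [p]; elim: {p}_.+1 {-2}p (ltnSn (size p)) => // n IH p size_p Lp [p0 pv].
have aYv : acl Y v by apply: (proj2 (acl_closed Y)); exists p => // i; case: (Lp i).
have [p'0|p'0] := eqVneq p^`().[v] 0.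
  have size_p1 : (1 < size p)%N.
    rewrite ltnNge; apply/negP => /size1_polyC pC; move: p0 pv.
    by rewrite pC rootC polyC_eq0 => /negPf->.
  apply: (IH p^`()).
  - by rewrite (leq_trans (lt_size_deriv p0)).
  - move=> i; rewrite coef_deriv; have [aY aDY] := Lp i.+1.
    move: aY aDY; set c := p`_i.+1; move: i.+1 c => j c aY aDY.
    elim: j => [|j [IH1 IH2]].
      by rewrite mulr0n D0; split; apply: (subfield0 YP).
    by rewrite mulrS DD; split; apply: (subfieldD YP); assumption.
  - split; last by apply/eqP.
    apply/negP => /eqP/(congr1 (fun q : {poly U} => q`_(size p).-2)).
    rewrite coef0 coef_deriv prednK ?prednK //; last by rewrite -ltnS prednK // ltnW.
    rewrite -lead_coefE -mulr_natr => /eqP; rewrite mulf_eq0 lead_coef_eq0 (negPf p0).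
    by rewrite /= (proj1 (pcharf0P U) char0) -(subnKC size_p1).
split=> //; set q := map_poly D p.
have Dp : D p.[v] = q.[v] + p^`().[v] * D v.
  rewrite {}/q; elim/poly_ind: {Lp p0 pv p'0 size_p} p => [|p c IHp].
    by rewrite map_poly0 deriv0 horner0 D0 mul0r addr0.
  have -> : map_poly D (p * 'X + c%:P) = map_poly D p * 'X + (D c)%:P.
    apply/polyP => i; rewrite coef_map_id0 // !coefD !coefMX !coefC DD.
    by case: (i == 0)%N; rewrite ?coef_map_id0 // D0.
  rewrite derivD derivM derivX derivC !hornerE DD DM IHp.
  rewrite !mulrDl -!addrA; congr (_ + _); rewrite [RHS]addrC -!addrA mulrAC.
  by congr (_ + _); rewrite addrC.
have -> : D v = - q.[v] / p^`().[v].
  apply: (mulIf p'0); rewrite divfK // mulrC; apply/eqP.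
  by rewrite -addr_eq0 addrC -Dp (eqP pv) D0.
apply: (subfield_div YP) => //; first apply: (subfieldN YP) => //.
- apply: (subfield_horner YP) => // i.
  by rewrite coef_map_id0 //; case: (Lp i).
- apply: (subfield_horner YP) => // i; rewrite coef_deriv.
  have [aY _] := Lp i.+1; move: aY; set c := p`_i.+1; move: i.+1 c => j c aY.
  elim: j => [|j IH1]; first by rewrite mulr0n; apply: (subfield0 YP).
  by rewrite mulrS; apply: (subfieldD YP).
Qed.

End AlgebraicClosure.

(** * Polynomial relations among derivatives *)

(** A nontrivial relation makes some variable algebraic over those before it, for whatever order [s]
    prescribes; the uses below choose this order. The relation is read as a polynomial in the last
    variable with coefficients [S d]. If a coefficient that has terms vanishes, it is a relation in
    fewer variables; otherwise the polynomial is nonzero and the last variable is algebraic over the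
    others. *)
Lemma monomial_dependence (U : fieldType) (V M : eqType) (E : U -> Prop)
    (x : V -> U) (ex : M -> V -> nat) (c : M -> U) (s : seq V) (T : seq M) :
  uniq T ->
  (forall k l, k \in T -> l \in T -> (forall v, v \in s -> ex k v = ex l v) ->
    k = l) ->
  (forall k, k \in T -> E (c k) /\ c k != 0) -> T != [::] ->
  \sum_(k <- T) c k * \prod_(v <- s) x v ^+ ex k v = 0 ->
  exists s1 v s2, s = s1 ++ v :: s2 /\
    acl (fun u => E u \/ exists2 w, w \in s1 & u = x w) (x v).
Proof.
elim/last_ind: s T => [|s v IH] T T_uniq T_inj T_E.
  case: T T_uniq T_inj T_E => [//|k T] /= /andP[kT _] T_inj T_E _.
  have -> : T = [::].
    case: T kT T_inj {T_E} => [//|l T] kT /(_ k l); rewrite !inE !eqxx !orbT.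
    by move=> /(_ isT isT) kl; move: kT; rewrite kl ?mem_head.
  have [_ ck0] := T_E k (mem_head _ _).
  by rewrite big_seq1 big_nil mulr1 => /eqP; rewrite (negPf ck0).
move=> T0 sumT; pose Td d := [seq k <- T | ex k v == d].
pose S d := \sum_(k <- Td d) c k * \prod_(w <- s) x w ^+ ex k w.
case: (pselect (exists d, Td d != [::] /\ S d = 0)) => [[d [Td0 Sd0]]|nS].
  have [|k l|k|s1 [w [s2 [-> aw]]]] := IH (Td d) _ _ _ Td0 Sd0.
  - exact: filter_uniq.
  - rewrite !mem_filter => /andP[/eqP kd kT] /andP[/eqP ld lT] kl.
    apply: T_inj => // w; rewrite mem_rcons inE => /predU1P[->|/kl//].
    by rewrite kd ld.
  - by rewrite mem_filter => /andP[_ /T_E].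
  by exists s1, w, (rcons s2 v); rewrite rcons_cat.
exists s, v, [::]; rewrite cats1; split => //.
set X := fun u => _; have aP := acl_subfield X.
apply: (proj2 (acl_closed X)).
pose N := (\max_(k <- T) ex k v).+1.
have ltN k : k \in T -> (ex k v < N)%N by move=> kT; rewrite ltnS; apply: leq_bigmax_seq.
exists (\poly_(d < N) S d).
  move=> d; rewrite coef_poly; case: ifP => _; last exact: (subfield0 aP).
  rewrite /S big_seq; apply: (subfield_sum aP) => k; rewrite mem_filter => /andP[_ kT].
  apply: (subfieldM aP); first by apply: acl_ext; left; case: (T_E k kT).
  rewrite big_seq; apply: (subfield_prod aP) => w ws; apply: (subfieldX aP).
  by apply: acl_ext; right; exists w.
split; last first.
  apply/eqP; rewrite -[RHS]sumT horner_poly.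
  under eq_bigr => d _ do rewrite /S big_filter big_distrl /=.
  rewrite (exchange_big_dep predT) //= big_seq [RHS]big_seq.
  apply: eq_bigr => k kT; rewrite (big_pred1 (Ordinal (ltN k kT))) => [|d].
    by rewrite /= -cats1 big_cat big_seq1 mulrA.
  by rewrite /= -val_eqE /= eq_sym.
have [k kT] : exists k, k \in T by case: (T) T0 => // k ? _; exists k; apply: mem_head.
apply/eqP => /(congr1 (fun q : {poly U} => q`_(ex k v))).
rewrite coef_poly ltN // coef0 => Sk; apply: nS; exists (ex k v); split => //.
by apply/eqP => Tk; have := mem_filter (fun l => ex l v == ex k v) k T; rewrite -/(Td _) Tk eqxx kT.
Qed.

Section DifferentialPolynomials.
Variables (m : nat) (U : diffFieldType m) (I : choiceType).
Implicit Types (E : U -> Prop) (x : I -> U) (P Q : dpoly U I) (k : dmonom m I).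

Definition dvar x (v : I * dop m) : U := dop_app v.2 (x v.1).

Lemma dmonom_evalEw x k (s : seq (I * dop m)) :
  uniq s -> (forall v, v \in finsupp k -> v \in s) ->
  dmonom_eval x k = \prod_(v <- s) dvar x v ^+ k v.
Proof.
move=> s_uniq ks; rewrite [RHS](bigID (mem (finsupp k))) /= [X in _ * X]big1.
  rewrite mulr1 -big_filter /dmonom_eval; apply: perm_big.
  apply: uniq_perm; rewrite ?fset_uniq ?filter_uniq // => v.
  by rewrite mem_filter; case: (boolP (v \in finsupp k)) => // /ks ->.
by move=> v; rewrite -cmE_eq0 => /eqP->; rewrite expr0.
Qed.

Lemma dmonom_eval_morph x : mmorphism (dmonom_eval x).
Proof.
split=> [k l|]; last by rewrite /dmonom_eval mdom1 big_seq_fset0.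
have kl v : v \in finsupp k \/ v \in finsupp l -> v \in (finsupp k `|` finsupp l)%fset.
  by rewrite in_fsetU => -[]->; rewrite ?orbT.
rewrite !(@dmonom_evalEw x _ (finsupp k `|` finsupp l)%fset) ?fset_uniq //.
- by rewrite -big_split; apply: eq_bigr => v _; rewrite cmM exprD.
- by move=> v vl; apply: kl; right.
- by move=> v vl; apply: kl; left.
- by move=> v; rewrite mdomD.
Qed.

HB.instance Definition _ x :=
  isMultiplicative.Build _ _ (dmonom_eval x) (dmonom_eval_morph x).

Lemma devalE x P : deval x P = \sum_(k <- msupp P) P@_k * dmonom_eval x k.
Proof. by []. Qed.

Lemma devalB x P Q : deval x (P - Q) = deval x P - deval x Q.
Proof. exact: (mmapB (f := idfun)). Qed.

Lemma deval_sum x (J : Type) (r : seq J) (F : J -> dpoly U I) :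
  deval x (\sum_(j <- r) F j) = \sum_(j <- r) deval x (F j).
Proof. exact: (raddf_sum (mmap idfun (dmonom_eval x))). Qed.

Lemma deval1 x : deval x 1 = 1.
Proof. exact: (rmorph1 (mmap idfun (dmonom_eval x))). Qed.

Lemma devalM x P Q : deval x (P * Q) = deval x P * deval x Q.
Proof. exact: (rmorphM (mmap idfun (dmonom_eval x))). Qed.

Lemma devalU x (c : U) k : deval x << c *g k >> = c * dmonom_eval x k.
Proof. exact: (mmapU (f := idfun)). Qed.

Lemma dpoly_dependence E x P (s : seq (I * dop m)) :
  dpoly_over E P -> P <> 0 -> deval x P = 0 -> uniq s ->
  (forall k v, k \in msupp P -> v \in finsupp k -> v \in s) ->
  exists s1 v s2, s = s1 ++ v :: s2 /\
    acl (fun u => E u \/ exists2 w, w \in s1 & u = dvar x w) (dvar x v).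
Proof.
move=> PE P0 Px s_uniq Ps.
apply: (@monomial_dependence _ _ (dmonom m I) _ _ (fun k v => k v) (fun k => P@_k)
         _ (msupp P)).
- exact: fset_uniq.
- move=> k l kP lP kl; apply/eqP/cmP => v.
  have [/kl//|vs] := boolP (v \in s).
  have [vk|] := boolP (v \in finsupp k); first by rewrite (Ps k) in vs.
  have [vl|] := boolP (v \in finsupp l); first by rewrite (Ps l) in vs.
  by rewrite -!cmE_eq0 => /eqP-> /eqP->.
- by move=> k kP; rewrite mcoeff_neq0.
- apply/eqP => PN; apply: P0; apply/malgP => k; rewrite mcoeff0.
  apply: mcoeff_outdom; apply/negP => kP.
  by have : k \in enum_fset (msupp P) by []; rewrite PN.
- rewrite -[RHS]Px devalE big_seq [RHS]big_seq; apply: eq_bigr => k kP.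
  by rewrite (@dmonom_evalEw x k s) // => v; apply: Ps.
Qed.

Definition dpoly_vars P : seq (I * dop m) :=
  undup (flatten [seq enum_fset (finsupp k) | k : dmonom m I <- msupp P]).

Lemma dpoly_varsP P v :
  reflect (exists2 k : dmonom m I, k \in msupp P & v \in finsupp k)
    (v \in dpoly_vars P).
Proof.
rewrite mem_undup; apply: (iffP flattenP) => [[_ /mapP[k kP ->] vk]|[k kP vk]].
  by exists k.
by exists (enum_fset (finsupp k)) => //; apply/mapP; exists k.
Qed.

Definition var_power (v : I * dop m) (i : nat) : dmonom m I :=
  [cmonom i | _ in fset1 v]%M.

Lemma var_powerE v i w : var_power v i w = if w == v then i else 0%N.
Proof. by rewrite /var_power cmE fsfunE inE. Qed.

Lemma dmonom_eval_power x v i : dmonom_eval x (var_power v i) = dvar x v ^+ i.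
Proof.
rewrite (@dmonom_evalEw x _ [:: v]) //; first by rewrite big_seq1 var_powerE eqxx.
move=> w; rewrite -cmE_neq0 var_powerE inE; by case: (w == v).
Qed.

(** After clearing denominators, a relation for the derivative [v] has as coefficients the values at
    [x] of differential polynomials [P i] free of [v]. Multiplying [P i] by the i-th power of [v]
    and summing gives a polynomial [Q] that vanishes at [x], hence is zero. *)
Lemma diff_indep_acl E x (v : I * dop m) : subfield E -> diff_indep E x ->
  ~ acl (fun u => E u \/ exists2 w, w != v & u = dvar x w) (dvar x v).
Proof.
move=> EP x_indep av.
pose R u := exists P, [/\ dpoly_over E P, forall k, k \in msupp P -> k v = 0%N
                        & u = deval x P].
have RU (c : U) k : E c -> k v = 0%N -> R (c * dmonom_eval x k).
  move=> Ec kv; exists << c *g k >>; rewrite devalU; split => // [l|l].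
    by rewrite mcoeffU; case: (k == l); rewrite ?mulr1n ?mulr0n //; apply: subfield0.
  by move=> /(fsubsetP msuppU_le); rewrite inE => /eqP->.
have R1 : R 1.
  have := RU 1 mone (subfield1 EP) (cm1 _).
  by rewrite (dmonom_eval_morph x).2 mulr1.
have RB a b : R a -> R b -> R (a - b).
  move=> [P [PE Pv ->]] [Q [QE Qv ->]]; exists (P - Q); split.
  - by move=> k; rewrite mcoeffB; apply: subfieldB.
  - by move=> k /(fsubsetP (msuppB_le _ _)); rewrite in_fsetU => /orP[/Pv|/Qv].
  - by rewrite devalB.
have RM a b : R a -> R b -> R (a * b).
  move=> [P [PE Pv ->]] [Q [QE Qv ->]]; exists (P * Q); split.
  - move=> k; rewrite mcoeffMl; apply: (subfield_sum EP) => i _.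
    apply: (subfield_sum EP) => j _.
    case: (_ == _); rewrite ?mulr1n ?mulr0n; last exact: (subfield0 EP).
    exact: (subfieldM EP).
  - by move=> k /msuppM_le[k1 [k2 [/Pv k1v /Qv k2v ->]]]; rewrite cmM k1v k2v.
  - by rewrite devalM.
have FP := fractions_subfield R1 RB RM.
have /(alg_over_fractions R1 RB RM)[p pR [p0 pv]] : alg_over (fractions R) (dvar x v).
  apply: av; first exact: alg_over_closed.
  have RF u : R u -> alg_over (fractions R) u.
    move=> Ru; apply: (sub_alg_over FP); exists u, 1.
    by rewrite oner_neq0 divr1.
  move=> u [Eu|[w wv ->]]; apply: RF.
    have := RU u mone Eu (cm1 _).
    by rewrite (dmonom_eval_morph x).2 mulr1.
  have wv1 : var_power w 1 v = 0%N by rewrite var_powerE eq_sym (negPf wv).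
  by have := RU 1 _ (subfield1 EP) wv1; rewrite dmonom_eval_power mul1r.
have {pR} /choice[P PP] := pR.
pose Q : dpoly U I := \sum_(i < size p) \sum_(k <- msupp (P i))
  << (P i)@_k *g mmul k (var_power v i) >>.
have QE : dpoly_over E Q.
  move=> l; rewrite raddf_sum /=; apply: (subfield_sum EP) => i _.
  rewrite raddf_sum /=; apply: (subfield_sum EP) => k _; rewrite mcoeffU.
  case: (_ == l); rewrite ?mulr1n ?mulr0n; last exact: (subfield0 EP).
  by case: (PP i).
have Qx : deval x Q = 0.
  rewrite -[RHS](eqP pv) horner_coef deval_sum; apply: eq_bigr => i _.
  have [_ _ ->] := PP i; rewrite deval_sum devalE big_distrl; apply: eq_bigr => k _.
  by rewrite devalU (dmonom_eval_morph x).1 dmonom_eval_power mulrA.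
case/negP: p0; apply/eqP/polyP => i; rewrite coef0.
have [ip|] := ltnP i (size p); last exact: nth_default.
have [_ Pv ->] := PP i; rewrite devalE big_seq big1 // => k kP.
(* The exponent of [v] in a monomial of [Q] recovers [i], so nothing cancels and every coefficient
   of [P i] is a coefficient of [Q]. *)
have := congr1 (mcoeff (mmul k (var_power v i))) (x_indep Q QE Qx).
rewrite mcoeff0 raddf_sum /= (bigD1 (Ordinal ip)) //= [X in _ + X]big1 => [|j ji].
  rewrite addr0 raddf_sum /= (bigD1_seq k) ?fset_uniq //= [X in _ + X]big1.
    by rewrite addr0 mcoeffUU => ->; rewrite mul0r.
  move=> l lk; rewrite mcoeffU; case: eqP => [E1|]; last by rewrite mulr0n.
  case/eqP: lk; apply/eqP/cmP => w; move/eqP/cmP: E1 => /(_ w).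
  by rewrite !cmM => /addIn.
rewrite raddf_sum /= big_seq big1 // => l lP; rewrite mcoeffU.
case: eqP => [/eqP/cmP/(_ v)|]; last by rewrite mulr0n.
have [_ Pjv _] := PP j; rewrite !cmM !var_powerE eqxx (Pv k kP) (Pjv l lP) !add0n => ij.
by case/eqP: ji; apply: val_inj.
Qed.

End DifferentialPolynomials.

(** * The monoid of derivative operators *)

Section DerivativeOperators.
Variable m : nat.
Implicit Types (t : dop m) (i : 'I_m).

Definition dop0 : dop m := [ffun=> 0%N].
Definition dop_add t t' : dop m := [ffun i => (t i + t' i)%N].
Definition dop1 i : dop m := [ffun j => (j == i : nat)].
Definition dop_le t t' : bool := [forall i, (t i <= t' i)%N].

Lemma dop_addA t t' t'' : dop_add t (dop_add t' t'') = dop_add (dop_add t t') t''.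
Proof. by apply/ffunP => i; rewrite !ffunE addnA. Qed.

Lemma dop_add0 t : dop_add dop0 t = t.
Proof. by apply/ffunP => i; rewrite !ffunE. Qed.

Lemma dop_addI t : injective (dop_add t).
Proof.
move=> t' t'' /ffunP e; apply/ffunP => i.
by have := e i; rewrite !ffunE => /addnI.
Qed.

Lemma dop_le_subnK t t' : dop_le t t' ->
  dop_add [ffun i => (t' i - t i)%N] t = t'.
Proof. by move=> /forallP le_t; apply/ffunP => i; rewrite !ffunE subnK. Qed.

Lemma dop_ind (Q : dop m -> Prop) :
  Q dop0 -> (forall i t, Q t -> Q (dop_add (dop1 i) t)) -> forall t, Q t.
Proof.
move=> Q0 Q1 t; have [n] := ubnP (\sum_i t i)%N; elim: n t => // n IH t lt_tn.
have [/forallP t0|] := boolP [forall i, t i == 0%N].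
  by suff -> : t = dop0 by []; apply/ffunP => i; rewrite ffunE; apply/eqP.
rewrite negb_forall => /existsP[i ti].
have -> : t = dop_add (dop1 i) [ffun j => (t j - (j == i))%N].
  apply/ffunP => j; rewrite !ffunE; case: (eqVneq j i) => [->|_]; last by rewrite add0n subn0.
  by rewrite subnKC // lt0n.
apply: Q1; apply: IH; rewrite -ltnS; apply: leq_trans lt_tn; rewrite ltnS.
rewrite (bigD1 i) //= [X in (_ < X)%N](bigD1 i) //= !ffunE eqxx.
rewrite -addSn leq_add //; first by lia.
by apply: leq_sum => j ji; rewrite ffunE (negPf ji) subn0.
Qed.

Variable U : diffFieldType m.
Implicit Types x : U.

Lemma dop_app0 x : dop_app dop0 x = x.
Proof. by rewrite /dop_app; elim: (enum _) => //= i s IH; rewrite ffunE. Qed.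

Lemma der_iter i j n x : der i (iter n (der j) x) = iter n (der j) (der i x).
Proof. by elim: n => //= n <-; rewrite derC. Qed.

Lemma dop_app1D i t x : dop_app (dop_add (dop1 i) t) x = der i (dop_app t x).
Proof.
rewrite /dop_app; set t' := dop_add _ _.
have same s : i \notin s -> foldr (fun i z => iter (t' i) (der i) z) x s =
    foldr (fun i z => iter (t i) (der i) z) x s.
  elim: s => //= j s IH; rewrite inE negb_or => /andP[ij /IH->].
  by rewrite !ffunE eq_sym (negPf ij).
have : i \in enum 'I_m by rewrite mem_enum.
elim: (enum _) (enum_uniq 'I_m) => //= j s IH /andP[js s_uniq].
rewrite inE; have [ij _|ij /= /(IH s_uniq)->] := eqVneq i j.
  by rewrite -ij in js *; rewrite same // !ffunE eqxx.
by rewrite der_iter !ffunE eq_sym (negPf ij).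
Qed.

End DerivativeOperators.

(** * Weights of operators and growth of their number *)

Section Weight.
Variables (m B : nat).
Hypothesis B_gt0 : (0 < B)%N.
Implicit Types (t : dop m) (h k : nat).

(** The exponents of [t] serve as digits in base [B]. This makes the weight additive, and injective
    on operators whose exponents are all below [B], so that it ranks the derivatives in a given
    polynomial without ties. *)
Definition weight t : nat := (\sum_(i < m) t i * B ^ i)%N.

Lemma weight0 : weight (dop0 m) = 0%N.
Proof. by apply: big1 => i _; rewrite ffunE. Qed.

Lemma weightD t t' : weight (dop_add t t') = (weight t + weight t')%N.
Proof.
by rewrite /weight -big_split /=; apply: eq_bigr => i _; rewrite ffunE mulnDl.
Qed.

Lemma weight_inj t t' : (forall i, t i < B)%N -> (forall i, t' i < B)%N ->
  weight t = weight t' -> t = t'.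
Proof.
rewrite /weight => tB t'B et; apply/ffunP.
suff digits : forall n (f g : 'I_n -> nat), (forall i, f i < B)%N ->
    (forall i, g i < B)%N ->
    (\sum_(i < n) f i * B ^ i = \sum_(i < n) g i * B ^ i)%N -> f =1 g.
  exact: digits.
elim=> [|n IH] f g fB gB; first by move=> _ [].
  rewrite !big_ord_recl !muln1.
  have shift (u : 'I_n.+1 -> nat) : (\sum_(i < n) u (lift ord0 i) * B ^ lift ord0 i)%N
      = (B * \sum_(i < n) u (lift ord0 i) * B ^ i)%N.
    by rewrite big_distrr /=; apply: eq_bigr => i _; rewrite /bump /= expnS mulnCA.
  rewrite !shift => e.
  have e0 : f ord0 = g ord0.
    have := congr1 (modn^~ B) e.
    by rewrite /= ![(B * _)%N]mulnC ![(_ + _ * B)%N]addnC !modnMDl !modn_small.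
  move: e; rewrite e0 => /addnI/eqP; rewrite eqn_pmul2l // => /eqP/IH eqfg i.
  case: (unliftP ord0 i) => [j ->|->] //.
  by apply: (eqfg (fun i => fB _) (fun i => gB _)).
Qed.

Definition weight_ball h : seq (dop m) :=
  [seq t <- [seq [ffun i => f i : nat] | f : {ffun 'I_m -> 'I_h.+1}]
     | (weight t <= h)%N].

Lemma mem_weight_ball h t : (t \in weight_ball h) = (weight t <= h)%N.
Proof.
rewrite mem_filter; case: leqP => //= le_th; apply/mapP.
have lt_th i : (t i < h.+1)%N.
  rewrite ltnS (leq_trans _ le_th) // /weight (bigD1 i) //=.
  by rewrite (leq_trans _ (leq_addr _ _)) // leq_pmulr // expn_gt0 B_gt0.
exists [ffun i => Ordinal (lt_th i)]; first by rewrite mem_enum.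
by apply/ffunP => i; rewrite !ffunE.
Qed.

Lemma weight_ball_uniq h : uniq (weight_ball h).
Proof.
apply: filter_uniq; rewrite map_inj_uniq ?enum_uniq // => f g /ffunP e.
by apply/ffunP => i; apply: val_inj; have := e i; rewrite !ffunE.
Qed.

Lemma size_weight_ball_gt0 h : (0 < size (weight_ball h))%N.
Proof.
have : dop0 m \in weight_ball h by rewrite mem_weight_ball weight0.
by case: (weight_ball h).
Qed.

Lemma leq_size_weight_ball h k : (h <= k)%N ->
  (size (weight_ball h) <= size (weight_ball k))%N.
Proof.
move=> le_hk; apply: uniq_leq_size (weight_ball_uniq h) _ => t.
by rewrite !mem_weight_ball => /leq_trans; apply.
Qed.

Lemma size_weight_ball h : (size (weight_ball h) <= h.+1 ^ m)%N.
Proof.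
rewrite size_filter (leq_trans (count_size _ _)) // size_map -cardE.
by rewrite card_ffun !card_ord.
Qed.

(** Adding [t0] injects the operators of weight at most [h] into the multiples of [t0] of weight at
    most [h + k]. *)
Lemma size_weight_ball_nonmultiples t0 h k : (weight t0 <= k)%N ->
  (size [seq t <- weight_ball (h + k) | ~~ dop_le t0 t] + size (weight_ball h)
   <= size (weight_ball (h + k)))%N.
Proof.
move=> le_t0k; rewrite -[leqRHS](count_predC (dop_le t0)) addnC size_filter leq_add2r.
rewrite -size_filter -(size_map (dop_add t0)); apply: uniq_leq_size.
  by rewrite (map_inj_uniq (@dop_addI _ t0)) weight_ball_uniq.
move=> _ /mapP[t + ->]; rewrite mem_weight_ball => tR.
rewrite mem_filter mem_weight_ball weightD.
rewrite addnC leq_add // andbT; apply/forallP => i.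
by rewrite ffunE leq_addr.
Qed.

End Weight.

(** By Bernoulli, (1 + 1/c)^c >= 2. So for j = c 2^l the quotient of the exponentials is at least
    2^(2^l), while the polynomial factor is at most 2^(m (ac + l + 1)). *)
Lemma expn_dominates_poly (c a m : nat) :
  exists j, (c ^ j * (a * j).+1 ^ m < c.+1 ^ j)%N.
Proof.
have [->|c_gt0] := posnP c; first by exists 1%N; rewrite expn1 mul0n.
have bernoulli j : (c ^ j.+1 + j.+1 * c ^ j <= c.+1 ^ j.+1)%N.
  elim: j => [|j IH]; first by rewrite !expn1 expn0 addn1.
  by rewrite expnS (expnS c.+1); move: IH; rewrite !(expnS c j); nia.
have two_exp i : (2 ^ i * c ^ (c * i) <= c.+1 ^ (c * i))%N.
  rewrite !expnM -expnMn; have [->|i_gt0] := posnP i; first by rewrite !expn0.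
  rewrite leq_exp2r //; have := bernoulli c.-1.
  by rewrite prednK // -expnS prednK // addnn -mul2n.
have lin : exists l, (m * (a * c + l).+1 < 2 ^ l)%N.
  (* For l = 2n, 2^l is at least (n + 1)^2, which exceeds m (ac + 1) + 2mn because n is at least 2m
     and at least m (ac + 1). *)
  exists (2 * (2 * m + m * (a * c + 1)))%N; set n := (2 * m + _)%N.
  have lt_n := ltn_expl n (isT : 1 < 2)%N; rewrite (mulnC 2 n) expnM.
  apply: leq_trans (_ : n.+1 ^ 2 <= _)%N; last by rewrite leq_exp2r.
  by rewrite /n; nia.
have [l lt_l] := lin; exists (c * 2 ^ l)%N.
apply: leq_trans (two_exp _); rewrite [(c ^ _ * _)%N]mulnC ltn_pmul2r ?expn_gt0 ?c_gt0 //.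
apply: leq_ltn_trans (_ : 2 ^ (m * (a * c + l).+1) < _)%N; last by rewrite ltn_exp2l.
rewrite (mulnC m) expnM; case: (posnP m) => [->|m_gt0]; first by rewrite !expn0.
rewrite leq_exp2r // expnS expnD mulnA.
have := ltn_expl (a * c) (isT : 1 < 2)%N; have : (0 < 2 ^ l)%N by rewrite expn_gt0.
nia.
Qed.

(* A function satisfying this recurrence grows exponentially. *)
Lemma poly_growth_absurd (f : nat -> nat) (q p k m : nat) :
  (forall h, 0 < f h)%N -> (forall h l, h <= l -> f h <= f l)%N ->
  (forall h, f h <= h.+1 ^ m)%N ->
  ~ (forall h, q.+1 * f h + p * f h <= q * f (h + k + k) + p * f (h + k))%N.
Proof.
move=> f_gt0 f_mono f_poly rec.
(* By monotonicity both radii on the right become [h + 2k]: each such step multiplies [f] by at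
   least (p + q + 1) / (p + q). *)
have step h : ((p + q).+1 * f h <= (p + q) * f (h + (k + k)))%N.
  rewrite addnA (_ : (p + q).+1 * f h = q.+1 * f h + p * f h)%N; last first.
    by rewrite -mulnDl addSn (addnC q).
  apply: leq_trans (rec h) _; rewrite mulnDl addnC leq_add2r leq_mul2l.
  by rewrite f_mono ?orbT ?leq_addr.
have iter_step j : ((p + q).+1 ^ j <= (p + q) ^ j * f ((k + k) * j))%N.
  elim: j => [|j IH]; first by rewrite !expn0 mul1n f_gt0.
  rewrite !expnS mulnS (addnC (k + k)%N); apply: leq_trans (leq_mul (leqnn _) IH) _.
  by rewrite mulnCA (mulnC (p + q)%N) -mulnA leq_mul2l step orbT.
have [j] := expn_dominates_poly (p + q) (k + k) m.
rewrite ltnNge => /negP; apply; apply: leq_trans (iter_step j) _.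
by rewrite leq_mul2l f_poly orbT.
Qed.

(** * Bounding independent differential transcendentals *)

Section DifferentialSubfields.
Variables (m : nat) (U : diffFieldType m).
Implicit Types (E F L X Y : U -> Prop) (I J : choiceType).

Lemma diff_subfield_subfield E : diff_subfield E -> subfield E.
Proof. by case. Qed.

Lemma diff_subfield_dop E t u : diff_subfield E -> E u -> E (dop_app t u).
Proof.
move=> [_ _ _ Eder] Eu; elim/dop_ind: t => [|i t IH]; first by rewrite dop_app0.
by rewrite dop_app1D; apply: Eder.
Qed.

Lemma diff_adjoin_subfield E I (x : I -> U) : diff_subfield (diff_adjoin E x).
Proof.
split=> [|u v Eu Ev|u v Eu Ev|i u Eu] L L_sub EL xL;
  have [L1 LB LV Lder] := L_sub.
- exact: L1.
- by apply: LB; [apply: Eu|apply: Ev].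
- by apply: LV; [apply: Eu|apply: Ev].
- by apply: Lder; apply: Eu.
Qed.

Lemma sub_diff_adjoin E I (x : I -> U) u : E u -> diff_adjoin E x u.
Proof. by move=> Eu L _ EL _; apply: EL. Qed.

Lemma mem_diff_adjoin E I (x : I -> U) i : diff_adjoin E x (x i).
Proof. by move=> L _ _; apply. Qed.

Lemma diff_adjoin_min E I (x : I -> U) L u : diff_subfield L ->
  (forall v, E v -> L v) -> (forall i, L (x i)) -> diff_adjoin E x u -> L u.
Proof. by move=> LP EL xL; apply. Qed.

Lemma diff_algebraic_mono E F u :
  (forall v, E v -> F v) -> diff_algebraic E u -> diff_algebraic F u.
Proof. by move=> EF [P [PE P0 Pu]]; exists P; split => // k; apply: EF. Qed.

Lemma not_diff_algebraic E u :
  ~ diff_algebraic E u -> diff_indep E (fun _ : unit => u).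
Proof.
move=> nu P PE Pu; apply: contrapT => P0; apply: nu.
by exists P.
Qed.

Variable U_char0 : [pchar U] =i pred0.

Lemma acl_diff_subfield E I (x : I -> U) : diff_subfield E ->
  diff_subfield (acl (fun u => E u \/ exists v : I * dop m, u = dvar x v)).
Proof.
move=> E_sub; set X := fun u => _.
have [X1 XB XV] := acl_subfield X; split=> // i u.
apply: (acl_derivation U_char0 (@derD m U i) (@derM m U i)); first exact: acl_ext.
move=> v [Ev|[[j t] ->]]; apply: acl_ext.
  by left; case: E_sub => _ _ _; apply.
by right; exists (j, dop_add (dop1 i) t); rewrite /dvar dop_app1D.
Qed.

Section Weighted.
Variables (E : U -> Prop) (B : nat).
Hypotheses (E_sub : diff_subfield E) (B_gt0 : (0 < B)%N).

Definition ders I (x : I -> U) (h : nat) (u : U) : Prop :=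
  exists i t, (weight B t <= h)%N /\ u = dop_app t (x i).

Lemma ders_mono I (x : I -> U) h k u : (h <= k)%N -> ders x h u -> ders x k u.
Proof. by move=> hk [i [t [th ->]]]; exists i, t; rewrite (leq_trans th). Qed.

Lemma ders_der I (x : I -> U) h i u :
  ders x h u -> ders x (h + weight B (dop1 i)) (der i u).
Proof.
move=> [j [t [th ->]]]; exists j, (dop_add (dop1 i) t).
by rewrite dop_app1D weightD addnC leq_add2r.
Qed.

Definition acl_over X : U -> Prop := acl (fun u => E u \/ X u).

Lemma acl_over_mono X Y u : (forall v, X v -> Y v) -> acl_over X u -> acl_over Y u.
Proof. by move=> XY; apply: acl_mono => v [|/XY]; [left|right]. Qed.

Lemma acl_over_ext X u : X u -> acl_over X u.
Proof. by move=> Xu; apply: acl_ext; right. Qed.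

Lemma acl_over_idem X Y u : (forall v, X v -> acl_over Y v) -> acl_over X u -> acl_over Y u.
Proof.
by move=> XY; apply: acl_idem => v [Ev|/XY//]; apply: acl_ext; left.
Qed.

Lemma acl_over_der X Y i u :
  (forall v, X v -> Y v) -> (forall v, X v -> Y (der i v)) ->
  acl_over X u -> acl_over Y (der i u).
Proof.
move=> XY XDY; apply: (acl_derivation U_char0 (@derD m U i) (@derM m U i)).
  by move=> v [Ev|/XY Yv]; apply: acl_ext; [left|right].
move=> v [Ev|/XDY Yv]; apply: acl_ext; [left|right] => //.
by case: E_sub => _ _ _; apply.
Qed.

(** The closure of E and all derivatives of [x] is a differential subfield, hence contains E<x>; by
    finite character, derivatives of bounded weight suffice for one element. *)
Lemma diff_adjoin_acl_over I (x : I -> U) u :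
  diff_adjoin E x u -> exists h, acl_over (ders x h) u.
Proof.
move=> xu; apply: (acl_directed (X := fun h v => E v \/ ders x h v)).
  by move=> k l v kl [Ev|xv]; [left|right; apply: ders_mono xv].
apply: acl_mono (xu _ (acl_diff_subfield x E_sub) _ _).
- move=> v [Ev|[[i t] ->]]; first by exists 0%N; left.
  by exists (weight B t); right; exists i, t.
- by move=> v Ev; apply: acl_ext; left.
- by move=> i; apply: acl_ext; right; exists (i, dop0 m); rewrite /dvar dop_app0.
Qed.

Lemma diff_adjoin2_acl_over I J (x : I -> U) (y : J -> U) u :
  diff_adjoin (diff_adjoin E x) y u ->
  exists h, acl_over (fun v => ders x h v \/ ders y h v) u.
Proof.
move=> xyu; pose z (v : I + J) := match v with inl i => x i | inr j => y j end.
have /diff_adjoin_acl_over[h zu] : diff_adjoin E z u.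
  apply: (diff_adjoin_min (L := diff_adjoin E z)) xyu; first exact: diff_adjoin_subfield.
    move=> v; apply: (diff_adjoin_min (L := diff_adjoin E z)); first exact: diff_adjoin_subfield.
      exact: sub_diff_adjoin.
    by move=> i; apply: (@mem_diff_adjoin E _ z (inl i)).
  by move=> j; apply: (@mem_diff_adjoin E _ z (inr j)).
exists h; apply: acl_over_mono zu => v [[i|j] [t [th ->]]]; [left; exists i|right; exists j];
  by exists t.
Qed.

Definition bounded_vars I (P : dpoly U I) : Prop :=
  forall k v i, k \in msupp P -> v \in finsupp k -> (v.2 i < B)%N.

(** With the variables of [P] sorted by weight, [dpoly_dependence] makes some derivative of [y]
    algebraic over the preceding ones. These have strictly smaller weight, as [bounded_vars]
    excludes ties. Finite character bounds the derivatives of [b] that express the coefficients. *)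
Lemma diff_algebraic_leader J (b : J -> U) (y : U) (P : dpoly U unit) :
  dpoly_over (diff_adjoin E b) P -> P <> 0 -> deval (fun=> y) P = 0 ->
  bounded_vars P ->
  exists k t0, (weight B t0 <= k)%N /\
    acl_over (fun u => ders b k u \/
           exists t, (weight B t < weight B t0)%N /\ u = dop_app t y) (dop_app t0 y).
Proof.
move=> PE P0 Py PB.
pose leW := relpre (fun v : unit * dop m => weight B v.2) leq.
pose s := sort leW (dpoly_vars P).
have s_uniq : uniq s by rewrite sort_uniq undup_uniq.
have [|s1 [[[] t0] [s2 [sE a0]]]] := dpoly_dependence PE P0 Py s_uniq.
  by move=> k v kP vk; rewrite mem_sort; apply/dpoly_varsP; exists k.
have leW_trans : transitive leW by move=> ? ? ?; apply: leq_trans.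
have s1_lt w : w \in s1 -> (weight B w.2 < weight B t0)%N.
  move=> ws1; have ws : w \in s by rewrite sE mem_cat ws1.
  have vs : (tt, t0) \in s by rewrite sE mem_cat mem_head orbT.
  have [k1 k1P wk] : exists2 k : dmonom m unit, k \in msupp P & w \in finsupp k.
    by apply/dpoly_varsP; rewrite -(mem_sort leW).
  have [k2 k2P vk] : exists2 k : dmonom m unit, k \in msupp P & (tt, t0) \in finsupp k.
    by apply/dpoly_varsP; rewrite -(mem_sort leW).
  have wv : w != (tt, t0).
    apply: contraTneq ws1 => ->; move: s_uniq; rewrite sE cat_uniq => /and3P[_ + _].
    by rewrite /= negb_or => /andP[].
  have : sorted leW s by apply: sort_sorted => ? ?; apply: leq_total.
  rewrite sE (sorted_pairwise leW_trans) pairwise_cat => /and3P[/allrelP+ _ _].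
  move=> /(_ w (tt, t0) ws1 (mem_head _ _)); rewrite /leW /= leq_eqVlt.
  case/predU1P => // e; case/eqP: wv; case: w {ws1 ws} wk e => [[] t] wk e.
  by congr (_, _); apply: (weight_inj B_gt0 _ _ e) => i; [apply: PB wk|apply: PB vk].
have [||k ak] := @acl_directed _ (fun k u => E u \/ (ders b k u \/
    exists t, (weight B t < weight B t0)%N /\ u = dop_app t y)) (dop_app t0 y).
- move=> k l v kl [Ev|[bv|?]]; [by left|right; left|by right; right].
  exact: ders_mono bv.
- apply: acl_idem a0 => v [/diff_adjoin_acl_over[h bv]|[w /s1_lt ws1 ->]].
    apply: acl_mono bv => w [Ew|bw]; exists h; [by left|by right; left].
  by apply: acl_ext; exists 0%N; right; right; exists w.2.
exists (maxn k (weight B t0)), t0; split; first exact: leq_maxr.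
apply: acl_over_mono ak => v [bv|?]; [left|by right].
by apply: ders_mono bv; apply: leq_maxl.
Qed.

(** Each derivation applied to the dependence raises all weights by the same amount, so the strict
    inequality persists. *)
Lemma leader_multiples J (b : J -> U) (y : U) k t0 t :
  acl_over (fun u => ders b k u \/
         exists t, (weight B t < weight B t0)%N /\ u = dop_app t y) (dop_app t0 y) ->
  acl_over (fun u => ders b (k + weight B t) u \/
         exists t', (weight B t' < weight B t + weight B t0)%N /\ u = dop_app t' y)
    (dop_app (dop_add t t0) y).
Proof.
move=> a0; elim/dop_ind: t => [|i t IH].
  by rewrite dop_add0 weight0 addn0 add0n.
rewrite -dop_addA dop_app1D weightD; apply: acl_over_der IH => v [bv|[t' [lt_t' ->]]].
- by left; apply: ders_mono bv; rewrite leq_add2l leq_addl.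
- by right; exists t'; split => //; rewrite -addnA ltn_addl.
- by left; rewrite (addnC (weight B (dop1 i))) addnA; apply: ders_der.
- right; exists (dop_add (dop1 i) t'); rewrite dop_app1D weightD -addnA.
  by rewrite ltn_add2l.
Qed.

(** A multiple of the leader is algebraic over derivatives of [y i] of smaller weight and
    derivatives of [b]; induction on the weight removes all multiples. *)
Lemma acl_over_nonmultiples I J (b : J -> U) (y : I -> U) (t0 : I -> dop m) k h i t :
  (forall i, acl_over (fun u => ders b k u \/
     exists t, (weight B t < weight B (t0 i))%N /\ u = dop_app t (y i))
     (dop_app (t0 i) (y i))) ->
  (weight B t <= h)%N ->
  acl_over (fun u => ders b (h + k) u \/ exists i t,
         [/\ (weight B t <= h)%N, ~~ dop_le (t0 i) t & u = dop_app t (y i)])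
    (dop_app t (y i)).
Proof.
move=> lead; have [n] := ubnP (weight B t); elim: n t => // n IH t lt_tn le_th.
have [le_t0|nle] := boolP (dop_le (t0 i) t); last first.
  by apply: acl_over_ext; right; exists i, t.
set t1 := [ffun j => (t j - t0 i j)%N] : dop m.
have tE : dop_add t1 (t0 i) = t by apply: dop_le_subnK.
have wE : weight B t = (weight B t1 + weight B (t0 i))%N by rewrite -tE weightD.
rewrite -tE; have := leader_multiples (t := t1) (lead i); apply: acl_over_idem.
move=> v [bv|[t' [lt_t' ->]]].
  apply: acl_over_ext; left; apply: ders_mono bv; rewrite addnC leq_add2r.
  by rewrite (leq_trans _ le_th) // wE leq_addr.
by rewrite -wE in lt_t'; apply: IH; [rewrite (leq_trans lt_t')|rewrite ltnW // (leq_trans lt_t')].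
Qed.

Lemma acl_over_dop I J (b : J -> U) (y : I -> U) z k t :
  acl_over (fun v => ders b k v \/ ders y k v) z ->
  acl_over (fun v => ders b (k + weight B t) v \/ ders y (k + weight B t) v) (dop_app t z).
Proof.
move=> az; elim/dop_ind: t => [|i t IH]; first by rewrite dop_app0 weight0 addn0.
rewrite dop_app1D weightD (addnC (weight B (dop1 i))) addnA.
apply: acl_over_der IH => v [bv|bv].
- by left; apply: ders_mono bv; rewrite leq_addr.
- by right; apply: ders_mono bv; rewrite leq_addr.
- by left; apply: ders_der.
- by right; apply: ders_der.
Qed.

End Weighted.

Lemma sumn_leq_const (T : Type) (s : seq T) (g : T -> nat) c :
  (forall i, g i <= c)%N -> (sumn [seq g i | i <- s] <= size s * c)%N.
Proof. by move=> gc; elim: s => //= i s IH; rewrite mulSn leq_add. Qed.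

(* The derivatives of z of weight at most h are algebraic over E and about    *)
(* #|J1| f(h) + o(f(h)) derivatives of b and y, where f(h) is the number of   *)
(* derivative operators of weight at most h.                                  *)
Theorem diff_indep_leq_card E (J1 I J2 : finType)
    (b : J1 -> U) (y : I -> U) (z : J2 -> U) :
  diff_subfield E ->
  (forall i, diff_algebraic (diff_adjoin E b) (y i)) ->
  (forall j, diff_adjoin (diff_adjoin E b) y (z j)) ->
  diff_indep E z -> (#|J2| <= #|J1|)%N.
Proof.
move=> E_sub y_alg z_in z_indep; rewrite leqNgt; apply/negP => lt_J.
have /choice[P PP] := y_alg.
(* [B] exceeds every exponent of a derivation in the finitely many [P i]. *)
have [B B_gt0 PB] : exists2 B, (0 < B)%N & forall i, bounded_vars B (P i).
  pose B1 (v : unit * dop m) := (\max_j v.2 j)%N.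
  pose B2 (k : dmonom m unit) := (\max_(v <- finsupp k) B1 v)%N.
  pose B3 i := (\max_(k <- msupp (P i)) B2 k)%N.
  exists (\max_i B3 i).+1%N => // i k v j kP vk; rewrite ltnS.
  apply: leq_trans (leq_bigmax (F := B3) i).
  rewrite /B3; apply: leq_trans (leq_bigmax_seq (F := B2) k kP isT).
  rewrite /B2; apply: leq_trans (leq_bigmax_seq (F := B1) v vk isT).
  exact: (leq_bigmax (F := fun j => v.2 j)).
have /choice[kt ktP] i : exists kt : nat * dop m, (weight B kt.2 <= kt.1)%N /\
    acl_over E (fun u => ders B b kt.1 u \/
      exists t, (weight B t < weight B kt.2)%N /\ u = dop_app t (y i))
      (dop_app kt.2 (y i)).
  have [PE P0 Py] := PP i.
  have [k [t0 H]] := diff_algebraic_leader E_sub B_gt0 PE P0 Py (PB i).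
  by exists (k, t0).
have /choice[kz kzP] j := diff_adjoin2_acl_over B E_sub (z_in j).
pose k := maxn (\max_i (kt i).1) (\max_j kz j).
have kt_le i : ((kt i).1 <= k)%N.
  by rewrite leq_max (leq_bigmax (F := fun i => (kt i).1)).
have kz_le j : (kz j <= k)%N.
  by rewrite leq_max (leq_bigmax (F := fun j => kz j)) orbT.
pose t0 i := (kt i).2.
pose f h := size (weight_ball m B h).
apply: (@poly_growth_absurd f #|J1| #|I| k m).
- by move=> h; apply: size_weight_ball_gt0.
- by move=> h l; apply: leq_size_weight_ball.
- by move=> h; apply: size_weight_ball.
move=> h.
(* Writing [z] in terms of derivatives of [b] and [y] costs [k], so weight [h + k] is needed for
   [y]. Reducing those to nonmultiples of the leaders costs another [k] in the derivatives of
   [b]. *)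
pose Gb := [seq dop_app t (b j) | j <- enum J1, t <- weight_ball m B (h + k + k)].
pose Gy := flatten [seq [seq dop_app t (y i) |
  t <- [seq t <- weight_ball m B (h + k) | ~~ dop_le (t0 i) t]] | i <- enum I].
pose s := [seq (j, t) | j <- enum J2, t <- weight_ball m B h].
have size_s : (size s <= size (Gb ++ Gy))%N.
  apply: (pregeometry_size (acl_pregeometry E) (x := dvar z) (B := fun=> False)).
  - by apply: allpairs_uniq; rewrite ?enum_uniq ?weight_ball_uniq // => -[? ?] [? ?].
  - move=> v vs av; apply: (diff_indep_acl (diff_subfield_subfield E_sub) z_indep (v := v)).
    by apply: acl_mono av => u [Eu|[//|[w /andP[_ wv] ->]]]; [left|right; exists w].
  - move=> _ /allpairsP[[j t] [_ /= tR ->]]; rewrite mem_weight_ball // in tR.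
    have := acl_over_dop (t := t) E_sub (kzP j); apply: (@acl_over_idem E).
    move=> u [[i [t' [le_t' ->]]]|[i [t' [le_t' ->]]]].
      apply: acl_over_ext; right; rewrite mem_cat; apply/orP; left.
      apply/allpairsP; exists (i, t'); rewrite mem_enum mem_weight_ball //=; split => //.
      by rewrite (leq_trans le_t') //; have := kz_le j; lia.
    have lead i' : acl_over E (fun u => ders B b k u \/ exists t,
        (weight B t < weight B (t0 i'))%N /\ u = dop_app t (y i')) (dop_app (t0 i') (y i')).
      by apply: acl_over_mono (proj2 (ktP i')) => v [bv|?]; [left; apply: ders_mono bv|right].
    have le_hk : (weight B t' <= h + k)%N.
      by rewrite (leq_trans le_t') // addnC leq_add.
    apply: acl_over_mono (acl_over_nonmultiples E_sub i lead le_hk).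
    move=> v [[j' [t2 [le_t2 ->]]]|[i' [t2 [le_t2 nle ->]]]]; right.
      rewrite mem_cat; apply/orP; left; apply/allpairsP; exists (j', t2).
      by rewrite mem_enum mem_weight_ball.
    rewrite mem_cat; apply/orP; right; apply/flattenP.
    exists [seq dop_app t (y i') | t <- [seq t <- weight_ball m B (h + k) | ~~ dop_le (t0 i') t]].
      by apply/mapP; exists i'; rewrite ?mem_enum.
    by apply/mapP; exists t2; rewrite // mem_filter nle mem_weight_ball.
move: size_s; rewrite size_cat !size_allpairs -!cardE => size_s.
have size_Gy : (size Gy + #|I| * f h <= #|I| * f (h + k))%N.
  have f_le : (f h <= f (h + k))%N by apply: leq_size_weight_ball; rewrite ?leq_addr.
  rewrite [leqLHS]addnC -leq_subRL ?leq_mul2l ?f_le ?orbT //.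
  rewrite -mulnBr size_flatten /shape -map_comp cardE.
  apply: sumn_leq_const => i; rewrite /= size_map leq_subRL // [leqLHS]addnC.
  by apply: size_weight_ball_nonmultiples => //; apply: leq_trans (proj1 (ktP i)) _.
apply: leq_trans (_ : #|J2| * f h + #|I| * f h <= _)%N.
  by rewrite leq_add2r leq_mul2r lt_J orbT.
apply: leq_trans (leq_add size_s (leqnn _)) _.
by rewrite -addnA leq_add2l.
Qed.

End DifferentialSubfields.

(** * Differential transcendence bases *)

Section TranscendenceBases.
Variables (m : nat) (U : diffFieldType m).
Hypothesis U_char0 : [pchar U] =i pred0.

(** Otherwise [z] alone would be an independent family of length 1, against the bound 0 given by an
    empty [b]. *)
Lemma diff_algebraic_adjoin E (I : finType) (x : I -> U) z : diff_subfield E ->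
  (forall i, diff_algebraic E (x i)) -> diff_adjoin E x z -> diff_algebraic E z.
Proof.
move=> E_sub x_alg xz; apply: contrapT => /not_diff_algebraic z_indep.
pose b0 (v : void) : U := 0.
suff : (#|{: unit}| <= #|{: void}|)%N by rewrite card_unit card_void.
apply: (diff_indep_leq_card U_char0 (b := b0) (y := x) E_sub _ _ z_indep).
  move=> i; apply: diff_algebraic_mono (x_alg i) => v; exact: sub_diff_adjoin.
move=> _; apply: (diff_adjoin_min (diff_adjoin_subfield _ _)) xz.
  by move=> v Ev; do 2 apply: sub_diff_adjoin.
by move=> i; apply: (@mem_diff_adjoin _ _ _ _ x).
Qed.

Variables (E : U -> Prop) (E_sub : diff_subfield E).

Lemma diff_indep_extend e (b : 'I_e -> U) (u : U) :
  diff_indep E b -> ~ diff_algebraic (diff_adjoin E b) u ->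
  diff_indep E (fun j : 'I_e.+1 => if unlift ord_max j is Some j' then b j' else u).
Proof.
move=> b_indep /not_diff_algebraic u_indep P PE; set b' := fun j => _ => Pb.
apply: contrapT => P0.
pose new : pred ('I_e.+1 * dop m) := fun v => v.1 == ord_max.
(* Derivatives of [b] precede those of [u]. A dependent derivative of [b] then contradicts the
   independence of [b], and one of [u] contradicts its transcendence over E<b>. *)
pose s := [seq v <- dpoly_vars P | ~~ new v] ++ [seq v <- dpoly_vars P | new v].
have s_uniq : uniq s.
  rewrite cat_uniq !filter_uniq ?undup_uniq // andbT; apply/hasPn => v.
  by rewrite !mem_filter => /andP[-> _].
have [|s1 [[j t] [s2 [sE a0]]]] := dpoly_dependence PE P0 Pb s_uniq.
  move=> k v kP vk; rewrite mem_cat !mem_filter -andb_orl orNb.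
  by apply/dpoly_varsP; exists k.
have s1_neq w : w \in s1 -> w != (j, t).
  move=> ws1; apply: contraTneq ws1 => ->.
  by move: s_uniq; rewrite sE cat_uniq /= negb_or => /and3P[_ /andP[]].
have s1_new w : w \in s1 -> new w -> new (j, t).
  move=> ws1; have : pairwise (fun w v => new w ==> new v) s.
    rewrite pairwise_cat; apply/and3P; split.
    - apply/allrelP => v v'; rewrite !mem_filter => /andP[/negPf-> _].
      by move=> /andP[->]; rewrite implybT.
    - by apply/(pairwiseP (ord0, dop0 m)) => k l kP lP _;
        have := mem_nth (ord0, dop0 m) kP; rewrite mem_filter => /andP[/negPf->].
    - apply/(pairwiseP (ord0, dop0 m)) => k l kP lP _.
      by have := mem_nth (ord0, dop0 m) lP; rewrite mem_filter => /andP[->]; rewrite implybT.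
  rewrite sE pairwise_cat => /and3P[/allrelP/(_ _ _ ws1 (mem_head _ _))/implyP+ _ _].
  exact.
have b'_old j' t' : dvar b' (lift ord_max j', t') = dvar b (j', t').
  by rewrite /dvar /b' /= liftK.
have b'_new t' : dvar b' (ord_max, t') = dop_app t' u.
  by rewrite /dvar /b' /= unlift_none.
have E_subf := diff_subfield_subfield E_sub.
case: (unliftP ord_max j) a0 s1_neq s1_new => [j' ->|->] a0 s1_neq s1_new.
  apply: (diff_indep_acl (v := (j', t)) E_subf b_indep); rewrite -b'_old.
  apply: acl_mono a0 => v [Ev|[[j1 t1] ws1 ->]]; [by left|right].
  case: (unliftP ord_max j1) ws1 => [j2 ->|->] ws1; last first.
    by have := s1_new _ ws1 (eqxx _); rewrite /new /= eq_sym (negPf (neq_lift _ _)).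
  exists (j2, t1) => //; apply: contraNneq (s1_neq _ ws1) => -[-> ->].
  by [].
have L_subf := diff_subfield_subfield (diff_adjoin_subfield E b).
apply: (diff_indep_acl (v := (tt, t)) L_subf u_indep); rewrite b'_new in a0.
apply: acl_mono a0 => v [Ev|[[j1 t1] ws1 ->]]; first by left; apply: sub_diff_adjoin.
case: (unliftP ord_max j1) ws1 => [j2 ->|->] ws1.
  left; rewrite b'_old; apply: (@diff_subfield_dop _ _ (diff_adjoin E b)).
    exact: diff_adjoin_subfield.
  exact: (@mem_diff_adjoin _ _ _ _ b).
right; exists (tt, t1); last by rewrite b'_new.
by apply: contraNneq (s1_neq _ ws1) => -[->].
Qed.

Lemma diff_indep_ord0 (b : 'I_0 -> U) : diff_indep E b.
Proof.
move=> P PE Pb; apply: contrapT => P0.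
by have [k [[]]|[|? ?] [? [? []]]] := dpoly_dependence (s := [::]) PE P0 Pb isT.
Qed.

(** A longest independent subfamily of [x]; [n] bounds its length. Choosing the basis among the
    coordinates lets the same choice [sg] be made at a point that specializes to [x]. *)
Lemma diff_trbasis_sub n (x : 'I_n -> U) :
  exists e (sg : 'I_e -> 'I_n), diff_trbasis E (diff_adjoin E x) (x \o sg).
Proof.
pose Q e := `[< exists sg : 'I_e -> 'I_n, diff_indep E (x \o sg) >].
have Q0 : exists e, Q e.
  have no : 'I_0 -> 'I_n by case.
  by exists 0%N; apply/asboolP; exists no; apply: diff_indep_ord0.
have Qn e : Q e -> (e <= n)%N.
  move=> /asboolP[sg sg_indep].
  pose y0 (v : void) : U := 0.
  suff : (#|'I_e| <= #|'I_n|)%N by rewrite !card_ord.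
  apply: (diff_indep_leq_card U_char0 (b := x) (y := y0) E_sub _ _ sg_indep) => // j.
  by apply: sub_diff_adjoin; apply: (@mem_diff_adjoin _ _ _ _ x).
case: (ex_maxnP Q0 Qn) => e /asboolP[sg sg_indep] e_max.
exists e, sg; split => //.
  by move=> j; apply: (@mem_diff_adjoin _ _ _ _ x).
have x_alg i : diff_algebraic (diff_adjoin E (x \o sg)) (x i).
  apply: contrapT => nx; have := diff_indep_extend sg_indep nx.
  set b' := fun j => _ => b'_indep.
  suff /e_max : Q e.+1 by rewrite ltnn.
  apply/asboolP; exists (fun j => if unlift ord_max j is Some j' then sg j' else i).
  rewrite (_ : _ \o _ = b') //; apply/funext => j; rewrite /b' /=.
  by case: (unlift ord_max j).
move=> z xz; apply: (diff_algebraic_adjoin (diff_adjoin_subfield _ _) x_alg).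
apply: (diff_adjoin_min (diff_adjoin_subfield _ _)) xz.
  by move=> v Ev; do 2 apply: sub_diff_adjoin.
by move=> i; apply: (@mem_diff_adjoin _ _ _ _ x).
Qed.
End TranscendenceBases.

(** * Substituting indeterminates *)

Section Renaming.
Variables (m : nat) (U : diffFieldType m) (I J : choiceType) (sg : J -> I).

Definition rename_monom (k : dmonom m J) : dmonom m I :=
  \big[mmul/mone]_(v <- finsupp k) var_power (sg v.1, v.2) (k v).

Lemma dmonom_eval_rename (x : I -> U) k :
  dmonom_eval x (rename_monom k) = dmonom_eval (x \o sg) k.
Proof.
have [evM ev1] := dmonom_eval_morph x.
rewrite /rename_monom (big_morph _ evM ev1); apply: eq_bigr => v _.
by rewrite dmonom_eval_power.
Qed.

Definition rename_dpoly (P : dpoly U J) : dpoly U I :=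
  \sum_(k <- msupp P) << P@_k *g rename_monom k >>.

Lemma deval_rename (x : I -> U) P : deval x (rename_dpoly P) = deval (x \o sg) P.
Proof.
rewrite /rename_dpoly deval_sum devalE; apply: eq_bigr => k _.
by rewrite devalU dmonom_eval_rename.
Qed.

Lemma dpoly_over_rename E P : subfield E -> dpoly_over E P ->
  dpoly_over E (rename_dpoly P).
Proof.
move=> E_sub PE k; rewrite raddf_sum /=; apply: (subfield_sum E_sub) => l _.
rewrite mcoeffU; case: (_ == k); rewrite ?mulr1n ?mulr0n //.
exact: (subfield0 E_sub).
Qed.
End Renaming.

(** * Generic points and components *)

Section Components.
Variables (m n : nat) (U : diffFieldType m) (F : U -> Prop).
Hypothesis F_sub : subfield F.
Implicit Types (x y g : 'I_n -> U) (P Q : dpoly U 'I_n).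

Hypothesis F_sat : forall Eq Neq : dpoly U 'I_n -> Prop,
  (forall P, Eq P -> dpoly_over F P) -> (forall Q, Neq Q -> dpoly_over F Q) ->
  (forall Qs : seq (dpoly U 'I_n), (forall Q, Q \in Qs -> Neq Q) ->
    exists x, (forall P, Eq P -> deval x P = 0) /\
              (forall Q, Q \in Qs -> deval x Q <> 0)) ->
  exists x, (forall P, Eq P -> deval x P = 0) /\ (forall Q, Neq Q -> deval x Q <> 0).

Definition specializes x g : Prop :=
  forall P, dpoly_over F P -> deval g P = 0 -> deval x P = 0.

Lemma specializes_trans x y z : specializes x y -> specializes y z -> specializes x z.
Proof. by move=> xy yz P PF /(yz P PF)/(xy P PF). Qed.

(** Relations at [g] persist at [x], so a specialization cannot have more independent
    coordinates. *)
Lemma specializes_diff_indep (J : choiceType) (sg : J -> 'I_n) x g :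
  specializes x g -> diff_indep F (x \o sg) -> diff_indep F (g \o sg).
Proof.
move=> xg x_indep P PF Pg; apply: x_indep => //; rewrite -deval_rename.
by apply: xg; [apply: dpoly_over_rename|rewrite deval_rename].
Qed.

Lemma specializes_dvariety V x g : dvariety F V -> specializes x g -> V g -> V x.
Proof.
move=> [S SF VS] xg /VS Vg; apply/VS => P SP; apply: xg (Vg P SP).
exact: SF.
Qed.

Lemma dvariety_hypersurface P : dpoly_over F P -> dvariety F (fun x => deval x P = 0).
Proof.
move=> PF; exists (fun Q => Q = P) => [_ ->//|x].
by split=> [Px Q ->|/(_ P erefl)].
Qed.

(** By irreducibility, a product of polynomials that do not vanish identically on [W] does not
    either. *)
Lemma irreducible_avoids W (Qs : seq (dpoly U 'I_n)) : irreducible_dvariety F W ->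
  (forall Q, Q \in Qs -> dpoly_over F Q /\ exists2 x, W x & deval x Q <> 0) ->
  exists2 x, W x & forall Q, Q \in Qs -> deval x Q <> 0.
Proof.
move=> [Wvar [x0 Wx0] Wirr] QsW.
suff [R [_ [x Wx Rx] RQ]] : exists R, [/\ dpoly_over F R,
    exists2 x, W x & deval x R <> 0 &
    forall x, deval x R <> 0 -> forall Q, Q \in Qs -> deval x Q <> 0].
  by exists x => //; apply: RQ.
elim: Qs QsW => [|Q Qs IH] QsW.
  exists 1; split => //.
    move=> k; rewrite mcoeff1; case: (k == _); [exact: subfield1|exact: subfield0].
  exists x0 => //; rewrite deval1.
  by apply/eqP; rewrite oner_neq0.
have [QF [x1 Wx1 Qx1]] := QsW Q (mem_head _ _).
have [|R [RF [x2 Wx2 Rx2] RQs]] := IH.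
  by move=> P PQs; apply: QsW; rewrite inE PQs orbT.
exists (Q * R); split.
- move=> k; rewrite mcoeffMl; apply: (subfield_sum F_sub) => i _.
  apply: (subfield_sum F_sub) => j _; case: (_ == _); rewrite ?mulr1n ?mulr0n.
    exact: (subfieldM F_sub).
  exact: (subfield0 F_sub).
- apply: contrapT => nQR.
  have [|WQ|WR] := Wirr _ _ (dvariety_hypersurface QF) (dvariety_hypersurface RF).
  + move=> x Wx; apply: contrapT => /not_orP[Qx Rx]; apply: nQR; exists x => //.
    by rewrite devalM; apply/eqP; rewrite mulf_neq0 //; apply/eqP.
  + by apply: Qx1; apply: WQ.
  + by apply: Rx2; apply: WR.
- move=> x; rewrite devalM => QRx P; rewrite inE => /predU1P[->|PQs].
    by move=> Qx; apply: QRx; rewrite Qx mul0r.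
  by apply: RQs => // Rx; apply: QRx; rewrite Rx mulr0.
Qed.

Lemma irreducible_generic_point W :
  irreducible_dvariety F W -> exists g, generic_point F W g.
Proof.
move=> Wirr.
have [||Qs QsN|g [gEq gNeq]] := @F_sat
  (fun P => dpoly_over F P /\ forall x, W x -> deval x P = 0)
  (fun Q => dpoly_over F Q /\ exists2 x, W x & deval x Q <> 0).
- by move=> P [].
- by move=> P [].
- have [x Wx Qsx] := irreducible_avoids Wirr QsN.
  by exists x; split=> // P [_]; apply.
exists g; split=> [|P PF Pg x Wx].
  have [[S SF WS] _ _] := Wirr; apply/WS => P SP; apply: gEq; split; first exact: SF.
  by move=> x /WS; apply.
by apply: contrapT => Px; apply: (gNeq P) => //; split => //; exists x.
Qed.

(** Zorn's lemma is applied to the points of [V] that specialize to [y], ordered by specialization.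
    The specializations of a maximal point [g] form the component: a larger irreducible W' has a
    generic point g' above [g], which by maximality is also a specialization of [g]. *)
Lemma component_through V y : dvariety F V -> V y ->
  exists W g, [/\ irreducible_component F V W, generic_point F W g & W y].
Proof.
move=> Vvar Vy; have [S SF VS] := Vvar.
pose T := {x : 'I_n -> U | V x /\ specializes y x}.
have y_self : V y /\ specializes y y by split=> // P.
pose R (u v : T) := `[< specializes (sval u) (sval v) >].
have [||A A_tot|[g [Vg yg]] g_max] :=
    @classical_sets.ZL_preorder T (exist _ y y_self) R.
- by move=> u; apply/asboolP => P.
- by move=> u v w /asboolP uv /asboolP vw; apply/asboolP; apply: specializes_trans vw.
- case: (pselect (exists c, A c)) => [[c0 Ac0]|nA]; last first.
    by exists (exist _ y y_self) => u Au; case: nA; exists u.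
  (* An upper bound of the chain satisfies exactly the equations common to all its members. Finitely
     many inequations hold at one member, since a nonzero value stays nonzero at more generic
     points. *)
  have [||Qs QsN|x [xEq xNeq]] := @F_sat
    (fun P => dpoly_over F P /\ forall c, A c -> deval (sval c) P = 0)
    (fun Q => dpoly_over F Q /\ exists2 c, A c & deval (sval c) Q <> 0).
  + by move=> P [].
  + by move=> P [].
  + suff [c Ac cQs] : exists2 c, A c & forall Q, Q \in Qs -> deval (sval c) Q <> 0.
      by exists (sval c); split=> // P [_]; apply.
    elim: Qs QsN => [|Q Qs IH] QsN; first by exists c0.
    have [|c Ac cQs] := IH; first by move=> P PQs; apply: QsN; rewrite inE PQs orbT.
    have [QF [c1 Ac1 Qc1]] := QsN Q (mem_head _ _).
    have [/asboolP cc1|/asboolP c1c] := A_tot c c1 Ac Ac1.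
      exists c1 => // P; rewrite inE => /predU1P[->//|PQs] Pc1.
      apply: (cQs P PQs); apply: cc1 Pc1.
      by have [|PF _] := QsN P; first by rewrite inE PQs orbT.
    exists c => // P; rewrite inE => /predU1P[->|/cQs//] Qc.
    by apply: Qc1; apply: c1c Qc.
  have spec_x c : A c -> specializes (sval c) x.
    move=> Ac P PF Px; apply: contrapT => Pc; apply: (xNeq P) => //.
    by split=> //; exists c.
  have Vx : V x.
    apply/VS => P SP; apply: xEq; split; first exact: SF.
    by move=> c _; have [/VS Vc _] := svalP c; apply: Vc.
  have yx : specializes y x.
    by apply: specializes_trans (spec_x _ Ac0); case: (svalP c0).
  by exists (exist _ x (conj Vx yx)) => c Ac; apply/asboolP/spec_x.
have Wvar : dvariety F (specializes^~ g).
  exists (fun P => dpoly_over F P /\ deval g P = 0) => [P []//|x].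
  by split=> [xg P [PF Pg]|H P PF Pg]; [apply: xg|apply: H].
have Wgen : generic_point F (specializes^~ g) g.
  by split=> // P PF Pg x xg; apply: xg.
exists (specializes^~ g), g; split => //; split.
- split=> // [|W1 W2 W1var W2var W12]; first by exists g.
  have [W1g|W2g] := W12 g (fun P _ => id); [left|right] => x xg.
    exact: specializes_dvariety xg W1g.
  exact: specializes_dvariety xg W2g.
- by move=> x xg; apply: (specializes_dvariety Vvar xg Vg).
move=> W' W'irr W'V WW' x W'x.
have [g' [W'g' g'gen]] := irreducible_generic_point W'irr.
have yg' : specializes y g'.
  by move=> P PF Pg'; apply: g'gen Pg' _ _ => //; apply: WW'.
have gg' : specializes g g'.
  by move=> P PF Pg'; apply: g'gen Pg' _ _ => //; apply: WW'.
have /asboolP g'g := g_max (exist _ g' (conj (W'V _ W'g') yg')) (introT (asboolP _) gg').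
by move=> P PF /(g'g P PF) Pg'; apply: g'gen Pg' _ _.
Qed.

End Components.

(** * The coordinates among the bounded monomials *)

Section SpecialMonomial.
Variables (m n s r : nat) (i : 'I_n).
Hypothesis r_gt0 : (0 < r)%N.

Fact bounded_dop0_subproof : (\sum_j ([ffun=> ord0] : {ffun 'I_m -> 'I_s.+1}) j <= s)%N.
Proof. by rewrite big1 // => j _; rewrite ffunE. Qed.

Definition bounded_dop0 : bounded_dop m s :=
  exist _ [ffun=> ord0] bounded_dop0_subproof.

Definition coordinate_exponents : {ffun 'I_n * bounded_dop m s -> 'I_r.+1} :=
  [ffun v => inord (v == (i, bounded_dop0))].

Lemma coordinate_exponentsE v :
  coordinate_exponents v = (v == (i, bounded_dop0)) :> nat.
Proof. by rewrite ffunE inordK //; case: (_ == _). Qed.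

Fact coordinate_subproof : (0 < \sum_v coordinate_exponents v <= r)%N.
Proof.
rewrite (bigD1 (i, bounded_dop0)) //= big1 => [|v vi].
  by rewrite coordinate_exponentsE eqxx addn0 r_gt0.
by rewrite coordinate_exponentsE (negPf vi).
Qed.

Definition coordinate_dmonom : bounded_dmonom m n s r :=
  exist _ coordinate_exponents coordinate_subproof.

Lemma coordinate_dmonom_eval (U : diffFieldType m) (y : 'I_n -> U) :
  bounded_dmonom_eval y coordinate_dmonom = y i.
Proof.
rewrite /bounded_dmonom_eval (bigD1 (i, bounded_dop0)) //= big1 => [|v vi].
  rewrite coordinate_exponentsE eqxx expr1 mulr1 -[RHS]dop_app0; congr dop_app.
  by apply/ffunP => j; rewrite !ffunE.
by rewrite coordinate_exponentsE (negPf vi) expr0.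
Qed.
End SpecialMonomial.

Lemma bounded_dmonom_eval_in m n s r (U : diffFieldType m) (L : U -> Prop)
    (y : 'I_n -> U) (e : bounded_dmonom m n s r) :
  diff_subfield L -> (forall i, L (y i)) -> L (bounded_dmonom_eval y e).
Proof.
move=> L_sub Ly; have L_subf := diff_subfield_subfield L_sub.
apply: (subfield_prod L_subf) => v _; apply: (subfieldX L_subf).
exact: diff_subfield_dop.
Qed.

Lemma image_pred_diff_subfield m (K U : diffFieldType m) (f : {rmorphism K -> U}) :
  diff_embedding f -> diff_subfield (image_pred f).
Proof.
move=> f_diff; split.
- by exists 1; rewrite rmorph1.
- by move=> _ _ [x <-] [y <-]; exists (x - y); rewrite rmorphB.
- by move=> _ _ [x <-] [y <-]; exists (x / y); rewrite fmorph_div.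
- by move=> i _ [x <-]; exists (der i x); rewrite f_diff.
Qed.

(* Counting the coefficients of the hypersurfaces *)
Local Close Scope ring_scope.

Theorem theorem5p2 (m n : nat) (K U : diffFieldType m)
  (K_char0 : ([pchar K] =i pred0)%R)
  (iota : {rmorphism K -> U}) (iota_diff : diff_embedding iota)
  (U_closed : diff_closed U) (U_large : large_over K U)
  (V : ('I_n -> U) -> Prop) (V_variety : dvariety (image_pred iota) V)
  (d : nat) (V_dim : dvariety_dim (image_pred iota) V d)
  (a : 'I_n -> U)
  (s r : 'I_d.+1 -> nat) (r_gt0 : forall j, 0 < r j)
  (c : forall j, bounded_dmonom m n (s j) (r j) -> U)
  (c_indep : diff_indep (diff_adjoin (image_pred iota) a) (all_coefficients c)) :
  (exists y, V y /\ forall j, hypersurface_through a (c j) y) ->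
  V a.
Proof.
move=> [y [Vy Hy]]; apply: contrapT => nVa.
have [i ya] : exists i, y i != a i.
  apply/not_existsP => ya; apply: nVa; rewrite (_ : a = y) //; apply/funext => i.
  by apply/esym/eqP/negPn/negP; apply: ya.
have U_char0 : ([pchar U] =i pred0)%R by move=> p; rewrite (fmorph_pchar iota) K_char0.
set F := image_pred iota in V_variety V_dim c_indep *.
have F_sub : diff_subfield F by apply: image_pred_diff_subfield.
(* [h] chooses preimages under [iota], with an arbitrary value outside F. *)
have F_card : exists h : U -> K, forall x y, F x -> F y -> h x = h y -> x = y.
  have /choice[h hP] u : exists k, F u -> iota k = u.
    by case: (pselect (F u)) => [[k ku]|nF]; [exists k|exists 0%R].
  by exists h => x z /hP {2}<- /hP {2}<- ->.
have F_subf := diff_subfield_subfield F_sub.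
have [W [g [Wcomp Wgen Wy]]] : exists W g,
    [/\ irreducible_component F V W, generic_point F W g & W y].
  apply: component_through => // Eq Neq EqF NeqF fin.
  apply: (U_large F F_sub F_card) => // Ps Qs PsEq QsNeq.
  by have [x [xEq xQs]] := fin Qs QsNeq; exists x; split=> // P /PsEq; apply: xEq.
have yg : specializes F y g by move=> P PF Pg; apply: (proj2 Wgen).
have [eg [sgg gbasis]] := diff_trbasis_sub U_char0 F_sub g.
have [ey [sgy [_ y_indep y_alg]]] := diff_trbasis_sub U_char0 F_sub y.
have eg_d : (eg <= d)%N.
  by apply: (proj2 V_dim) Wcomp _; exists g => //; exists (g \o sgg).
have ey_eg : (ey <= eg)%N.
  have [_ _ g_alg] := gbasis.
  suff : (#|'I_ey| <= #|'I_eg|)%N by rewrite !card_ord.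
  apply: (diff_indep_leq_card (b := g \o sgg) (y := g) U_char0 F_sub _ _
    (specializes_diff_indep F_subf yg y_indep)) => j.
    by apply: g_alg; apply: (@mem_diff_adjoin _ _ _ _ g).
  exact: (@mem_diff_adjoin _ _ _ _ g).
pose Fa := diff_adjoin F a; have Fa_sub : diff_subfield Fa by apply: diff_adjoin_subfield.
pose idx := {j : 'I_d.+1 & bounded_dmonom m n (s j) (r j)}.
pose e0 j := coordinate_dmonom m (s j) i (r_gt0 j).
(* The d + 1 special indices, those of the coefficient of y_i in each hypersurface; in [J1] they are
   replaced by a basis of F<y>, of length at most d. *)
pose sp j : idx := Tagged (fun j => bounded_dmonom m n (s j) (r j)) (e0 j).
have sp_inj : injective sp by move=> j j' /(congr1 tag).
pose J1 := ('I_ey + {p : idx | p \notin codom sp})%type.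
pose b (v : J1) : U :=
  match v with inl k => y (sgy k) | inr p => all_coefficients c (val p) end.
suff : (#|{: idx}| <= #|{: J1}|)%N.
  rewrite card_sum card_ord card_sig.
  have cN : (d.+1 + #|[pred p : idx | p \notin codom sp]| = #|{: idx}|)%N.
    have <- := cardC (mem (codom sp)).
    by rewrite (card_codom sp_inj) card_ord; congr addn; apply: eq_card.
  rewrite leqNgt => /negP; apply; rewrite -cN addSn ltnS leq_add2r.
  exact: leq_trans eg_d.
apply: (diff_indep_leq_card (b := b) (y := y) U_char0 Fa_sub _ _ c_indep).
  move=> k; apply: diff_algebraic_mono (y_alg _ (@mem_diff_adjoin _ _ _ _ y k)).
  move=> v; apply: (diff_adjoin_min (diff_adjoin_subfield _ _)).
    by move=> w Fw; do 2 apply: sub_diff_adjoin.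
  by move=> j; apply: (@mem_diff_adjoin _ _ _ _ b (inl j)).
set L := diff_adjoin _ _; have L_sub : diff_subfield L by apply: diff_adjoin_subfield.
have L_subf := diff_subfield_subfield L_sub.
have Ly k : L (y k) by apply: (@mem_diff_adjoin _ _ _ _ y).
have La k : L (a k) by do 2 apply: sub_diff_adjoin; apply: (@mem_diff_adjoin _ _ _ _ a).
have Lb p : p \notin codom sp -> L (all_coefficients c p).
  move=> np; apply: sub_diff_adjoin.
  exact: (@mem_diff_adjoin _ _ _ _ b (inr (exist _ p np))).
move=> p; have [/codomP[j ->]|/Lb//] := boolP (p \in codom sp).
(* The equation of the hypersurface is solved for its special coefficient, dividing by y_i - a_i. *)
have := Hy j; rewrite /hypersurface_through (bigD1 (e0 j)) //= !coordinate_dmonom_eval.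
move/eqP; rewrite addr_eq0 => /eqP cE.
have ya0 : (y i - a i != 0)%R by rewrite subr_eq0.
rewrite /all_coefficients /= -[c j (e0 j)](mulfK ya0) cE.
apply: (subfield_div L_subf); last exact: (subfieldB L_subf).
apply: (subfieldN L_subf); apply: (subfield_sum L_subf) => e ee0.
apply: (subfieldM L_subf); last first.
  by apply: (subfieldB L_subf); apply: bounded_dmonom_eval_in.
apply: (Lb (Tagged (fun j => bounded_dmonom m n (s j) (r j)) e)).
apply/codomP => -[j' /eqP E]; have jj' := congr1 tag (eqP E).
move: E; rewrite /= in jj'; rewrite -{j'}jj' /sp => /eqP/eqP; rewrite eq_Tagged.
by rewrite (negPf ee0).
Qed.
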